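(* If $\mu$ is a singular Borel probability measure on $[0,1)$, then $\{e^{2\pi i nx}\}_{n=0}^{\infty}\subseteq L^2(\mu)$ cannot be extended to a CFC sequence in $L^2(\mu)$.
   Context: Singular means singular with respect to Lebesgue measure on $[0,1)$. A countable family $\{f_n\}$ in a Hilbert space $\mathcal{H}$ is a CFC sequence if there is a bounded linear operator $B\in B(\mathcal{H})$ such that $\{Bf_n\}$ is a Parseval frame in $\mathcal{H}$, i.e. $\sum_n|\langle f,Bf_n\rangle|^2=\|f\|^2$ for all $f\in\mathcal{H}$. Here $\mathcal{H}=L^2(\mu)$. A sequence $\{f_n\}$ can be extended to a CFC sequence if there is a countable family $\{h_m\}\subseteq\mathcal{H}$ such that the combined family $\{f_n\}\cup\{h_m\}$ (counted with multiplicity) is a CFC sequence. *)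

(* Defs.v *)
From HB Require Import structures.
From mathcomp Require Import all_boot all_order all_algebra.
From mathcomp Require Import complex.
From mathcomp Require Import generic_quotient ring_quotient sesquilinear.
From mathcomp Require Import all_classical all_reals all_analysis.
From mathcomp Require Import measurable_realfun.

Set Implicit Arguments.
Unset Strict Implicit.
Unset Printing Implicit Defensive.

Import Order.TTheory GRing.Theory Num.Def Num.Theory.
Import numFieldNormedType.Exports.

Local Open Scope classical_set_scope.
Local Open Scope ring_scope.
Local Open Scope quotient_scope.

Local Notation Re := complex.Re.
Local Notation Im := complex.Im.

Section ComplexL2.
Context d (T : measurableType d) (R : realType).
Variable mu : {measure set T -> \bar R}.
Local Notation C := R[i].

(* There is no measurable structure on R[i]: integrals, integrability and L^2
   membership of complex functions are taken on real and imaginary parts. *)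
Definition cintegral (f : T -> C) : C :=
  Complex (\int[mu]_x Re (f x)) (\int[mu]_x Im (f x)).

Definition cintegrable (f : T -> C) : Prop :=
  mu.-integrable setT (EFin \o (fun x => Re (f x))) /\
  mu.-integrable setT (EFin \o (fun x => Im (f x))).

Definition cLfun2 : {pred T -> C} :=
  [pred f : T -> C | ((fun x => Re (f x)) \in Lfun mu 2%:E) &&
                     ((fun x => Im (f x)) \in Lfun mu 2%:E)].

Lemma cLfun2_submod : submod_closed cLfun2.
Proof.
have l2 : (1 <= 2%:E :> \bar R)%E by rewrite lee_fin ler1n.
have [L0 LD] := Lfun_submod_closed mu l2.
have LZ : forall (a : R) (f : T -> R), f \in Lfun mu 2%:E ->
    (fun x => a * f x) \in Lfun mu 2%:E.
  by move=> a f Lf; have := LD a f 0 Lf L0; rewrite addr0.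
have LA : forall f g : T -> R, f \in Lfun mu 2%:E -> g \in Lfun mu 2%:E ->
    (fun x => f x + g x) \in Lfun mu 2%:E.
  by move=> f g Lf Lg; have := LD 1 f g Lf Lg; rewrite scale1r.
split; first by rewrite inE /=; apply/andP; split; exact: L0.
move=> a f g /andP[/= f1 f2] /andP[/= g1 g2]; apply/andP; split => /=.
- have -> : (fun x => Re ((a *: f + g) x)) =
    (fun x => (Re a * Re (f x) + (- Im a) * Im (f x)) + Re (g x)).
    apply/funext => x; rewrite [(a *: f + g) x]/(a * f x + g x).
    by case: a => a b; case: (f x) => c e; case: (g x) => h k /=; rewrite mulNr.
  by apply: (LA) => //; apply: (LA); apply: (LZ).
- have -> : (fun x => Im ((a *: f + g) x)) =
    (fun x => (Re a * Im (f x) + Im a * Re (f x)) + Im (g x)).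
    apply/funext => x; rewrite [(a *: f + g) x]/(a * f x + g x).
    by case: a => a b; case: (f x) => c e; case: (g x) => h k /=.
  by apply: (LA) => //; apply: (LA); apply: (LZ).
Qed.

HB.instance Definition _ := GRing.isSubmodClosed.Build C (T -> C) cLfun2 cLfun2_submod.

Record L2fun := MkL2fun { L2fun_val :> T -> C ; _ : L2fun_val \in cLfun2 }.

HB.instance Definition _ := [isSub for L2fun_val].
HB.instance Definition _ := [Choice of L2fun by <:].
HB.instance Definition _ := [SubChoice_isSubLmodule of L2fun by <:].

Lemma L2fun_addE (f g : L2fun) x : (f + g) x = f x + g x. Proof. by []. Qed.
Lemma L2fun_subE (f g : L2fun) x : (f - g) x = f x - g x. Proof. by []. Qed.
Lemma L2fun_scaleE a (f : L2fun) x : (a *: f) x = a * f x. Proof. by []. Qed.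

Definition L2null : {pred L2fun} :=
  [pred f : L2fun | `[< {ae mu, forall x, f x = 0} >]].

Lemma L2null_zmod : zmod_closed L2null.
Proof.
split; first by apply/asboolP; exact: aeW.
move=> f g /asboolP f0 /asboolP g0; apply/asboolP.
by apply: filterS2 f0 g0 => x fx gx; rewrite L2fun_subE fx gx subr0.
Qed.

HB.instance Definition _ := GRing.isZmodClosed.Build L2fun L2null L2null_zmod.

(* L^2(mu), complex-valued: functions are identified when a.e. equal. *)
Definition L2 : Type := Quotient.quot L2null.
HB.instance Definition _ := Choice.on L2.
HB.instance Definition _ := EqQuotient.on L2.
HB.instance Definition _ := GRing.Zmodule.on L2.

Lemma L2fun_ae_eqP (f g : L2fun) :
  reflect {ae mu, forall x, f x = g x} (f == g %[mod L2]).
Proof.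
rewrite -Quotient.idealrBE; apply: (iffP idP) => [/asboolP|] h.
  by apply: filterS h => x /eqP; rewrite L2fun_subE subr_eq0 => /eqP.
by apply/asboolP; apply: filterS h => x fg; rewrite L2fun_subE fg subrr.
Qed.

Definition L2class (f : L2fun) : L2 := \pi_L2 f.

Lemma L2classP (f g : L2fun) :
  L2class f = L2class g <-> {ae mu, forall x, f x = g x}.
Proof. by split => [/eqP/L2fun_ae_eqP|/L2fun_ae_eqP/eqP]. Qed.

Lemma L2reprK (f : L2) : L2class (repr f) = f.
Proof. exact: reprK. Qed.

Lemma L2class_repr (f : L2fun) : {ae mu, forall x, repr (L2class f) x = f x}.
Proof. by apply/L2classP; rewrite L2reprK. Qed.

Lemma L2classD (f g : L2fun) : L2class (f + g) = L2class f + L2class g.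
Proof. exact: (@Quotient.pi_add _ (L2null : zmodClosed _)). Qed.

Lemma L2class0 : L2class 0 = 0.
Proof. by apply: (addrI (L2class 0)); rewrite -L2classD !addr0. Qed.

Definition L2scale (a : C) (f : L2) : L2 := L2class (a *: repr f).

Lemma L2scale_class a (f : L2fun) : L2scale a (L2class f) = L2class (a *: f).
Proof.
by apply/L2classP; apply: filterS (L2class_repr f) => x fx; rewrite !L2fun_scaleE fx.
Qed.

Lemma L2scalerA a b f : L2scale a (L2scale b f) = L2scale (a * b) f.
Proof. by rewrite -(L2reprK f) !L2scale_class scalerA. Qed.

Lemma L2scale1r : left_id 1 L2scale.
Proof. by move=> f; rewrite -(L2reprK f) L2scale_class scale1r. Qed.

Lemma L2scalerDr : right_distributive L2scale +%R.
Proof.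
move=> a f g; rewrite -(L2reprK f) -(L2reprK g) -L2classD !L2scale_class.
by rewrite scalerDr L2classD.
Qed.

Lemma L2scalerDl f : {morph L2scale^~ f : a b / a + b}.
Proof.
by move=> a b; rewrite -(L2reprK f) !L2scale_class scalerDl L2classD.
Qed.

HB.instance Definition _ :=
  GRing.Zmodule_isLmodule.Build C L2 L2scalerA L2scale1r L2scalerDr L2scalerDl.

Lemma L2classZ a (f : L2fun) : L2class (a *: f) = a *: L2class f.
Proof. by rewrite -L2scale_class. Qed.

(* <f, g> is the integral of f g^*; it is linear in the first argument and
   independent of the representatives by L2dot_class. *)
Definition L2dot (f g : L2) : C := cintegral (fun x => repr f x * (repr g x)^*).

Lemma eq_cintegral (f g : T -> C) : f =1 g -> cintegral f = cintegral g.
Proof. by move=> fg; congr cintegral; apply/funext. Qed.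

Lemma ae_eq_cintegral (f g : T -> C) : cintegrable f -> cintegrable g ->
  {ae mu, forall x, f x = g x} -> cintegral f = cintegral g.
Proof.
move=> [f1 f2] [g1 g2] fg; rewrite /cintegral /Rintegral.
congr (Complex (fine _) (fine _)); apply: ae_eq_integral => //.
- exact: measurable_int f1.
- exact: measurable_int g1.
- by apply: filterS fg => x /= ->.
- exact: measurable_int f2.
- exact: measurable_int g2.
- by apply: filterS fg => x /= ->.
Qed.

Lemma cintegrable_comb a (f g : T -> C) : cintegrable f -> cintegrable g ->
  cintegrable (fun x => a * f x + g x).
Proof.
move=> [f1 f2] [g1 g2]; split.
- have -> : EFin \o (fun x => Re (a * f x + g x)) =
    (fun x => (Re a)%:E * (Re (f x))%:E + (- Im a)%:E * (Im (f x))%:E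
      + (Re (g x))%:E)%E.
    apply/funext => x /=; rewrite -!EFinM -!EFinD; congr EFin.
    by case: a => a b; case: (f x) => c e; case: (g x) => h k /=; rewrite mulNr.
  by apply: integrableD => //; apply: integrableD => //; exact: integrableZl.
- have -> : EFin \o (fun x => Im (a * f x + g x)) =
    (fun x => (Re a)%:E * (Im (f x))%:E + (Im a)%:E * (Re (f x))%:E
      + (Im (g x))%:E)%E.
    apply/funext => x /=; rewrite -!EFinM -!EFinD; congr EFin.
    by case: a => a b; case: (f x) => c e; case: (g x) => h k /=.
  by apply: integrableD => //; apply: integrableD => //; exact: integrableZl.
Qed.

Lemma cintegral_comb a (f g : T -> C) : cintegrable f -> cintegrable g ->
  cintegral (fun x => a * f x + g x) = a * cintegral f + cintegral g.
Proof.
have Z (r : R) h : mu.-integrable setT (EFin \o h) ->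
    mu.-integrable setT (EFin \o (fun x => r * h x)).
  by move=> ih; exact: (integrableZl measurableT r ih).
have D (h k : T -> R) : mu.-integrable setT (EFin \o h) ->
    mu.-integrable setT (EFin \o k) ->
    mu.-integrable setT (EFin \o (fun x => h x + k x)).
  by move=> ih ik; exact: (integrableD measurableT ih ik).
move=> [f1 f2] [g1 g2]; rewrite /cintegral.
have -> : (fun x => Re (a * f x + g x)) =
    (fun x => (Re a * Re (f x) + (- Im a) * Im (f x)) + Re (g x)).
  apply/funext => x.
  by case: a => a b; case: (f x) => c e; case: (g x) => h k /=; rewrite mulNr.
have -> : (fun x => Im (a * f x + g x)) =
    (fun x => (Re a * Im (f x) + Im a * Re (f x)) + Im (g x)).
  apply/funext => x.
  by case: a => a b; case: (f x) => c e; case: (g x) => h k /=.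
rewrite !RintegralD//; do ?[by apply: (D) => //; apply: (Z)|by apply: (Z)].
rewrite !RintegralZl//.
by case: a => a b /=; rewrite mulNr.
Qed.

Lemma cintegral_conj (f : T -> C) : cintegrable f ->
  cintegral (fun x => (f x)^*) = (cintegral f)^*.
Proof.
move=> [f1 f2]; rewrite /cintegral.
have -> : (fun x => Re (f x)^*) = (fun x => Re (f x)).
  by apply/funext => x; case: (f x).
have -> : (fun x => Im (f x)^*) = (fun x => -1 * Im (f x)).
  by apply/funext => x; case: (f x) => u v /=; rewrite mulN1r.
by rewrite RintegralZl// mulN1r.
Qed.

Lemma L2fun_mul_integrable (f g : L2fun) :
  cintegrable (fun x => f x * (g x)^*).
Proof.
have ii : forall u v : T -> R, u \in Lfun mu 2%:E -> v \in Lfun mu 2%:E ->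
    mu.-integrable setT (fun x => (u x)%:E * (v x)%:E)%E.
  by move=> u v Lu Lv; have /Lfun1_integrable := Lfun2_mul_Lfun1 Lu Lv.
case: f => f /= /andP[/= f1 f2]; case: g => g /= /andP[/= g1 g2].
split.
- have -> : EFin \o (fun x => Re (f x * (g x)^*)) =
    (fun x => (Re (f x))%:E * (Re (g x))%:E + (Im (f x))%:E * (Im (g x))%:E)%E.
    apply/funext => x /=; rewrite -!EFinM -!EFinD; congr EFin.
    by case: (f x) => c e; case: (g x) => h k /=; rewrite mulrN opprK.
  by apply: integrableD => //; exact: ii.
- have -> : EFin \o (fun x => Im (f x * (g x)^*)) =
    (fun x => (Im (f x))%:E * (Re (g x))%:E - (Re (f x))%:E * (Im (g x))%:E)%E.
    apply/funext => x /=; rewrite -!EFinM -!EFinB; congr EFin.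
    by case: (f x) => c e; case: (g x) => h k /=; rewrite mulrN addrC.
  by apply: integrableB => //; exact: ii.
Qed.

Lemma L2dot_class (f g : L2fun) :
  L2dot (L2class f) (L2class g) = cintegral (fun x => f x * (g x)^*).
Proof.
apply: ae_eq_cintegral; [exact: L2fun_mul_integrable..|].
by apply: filterS2 (L2class_repr f) (L2class_repr g) => x /= -> ->.
Qed.

Lemma L2dot_hermitian f g : L2dot f g = (-1) ^+ false * conjC (L2dot g f).
Proof.
rewrite expr0 mul1r -cintegral_conj; last exact: L2fun_mul_integrable.
by apply: eq_cintegral => x; rewrite rmorphM /= conjCK mulrC.
Qed.

Lemma L2dot_linearl g : GRing.linear_for *%R (L2dot^~ g).
Proof.
move=> a f h; rewrite -(L2reprK f) -(L2reprK g) -(L2reprK h).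
rewrite -L2classZ -L2classD !L2dot_class -cintegral_comb;
  [|exact: L2fun_mul_integrable..].
by apply: eq_cintegral => x /=; rewrite mulrDl mulrA.
Qed.

Lemma L2dot_linearr f : GRing.linear_for (conjC \; *%R) (L2dot f).
Proof.
move=> a g h; rewrite 3!(L2dot_hermitian f) !expr0 !mul1r.
by rewrite L2dot_linearl rmorphD rmorphM.
Qed.

HB.instance Definition _ := bilinear_isBilinear.Build C L2 L2 C *%R
  (conjC \; *%R) L2dot (L2dot_linearl, L2dot_linearr).
HB.instance Definition _ :=
  isHermitianSesquilinear.Build C L2 false conjC L2dot L2dot_hermitian.

Lemma L2dot_gt0 f : f != 0 -> 0 < L2dot f f.
Proof.
rewrite -(L2reprK f); set u := repr f => /eqP u0.
pose q x := Re (u x) ^+ 2 + Im (u x) ^+ 2.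
have uuE x : u x * (u x)^* = Complex (q x) 0.
  rewrite /q; case: (u x) => v w; apply/eqP.
  by rewrite eq_complex /= !mulrN opprK !expr2 [w * v]mulrC addNr !eqxx.
have [iq _] := L2fun_mul_integrable u u.
have {}iq : mu.-integrable setT (EFin \o q).
  by congr (mu.-integrable _ _): iq; apply/funext => x /=; rewrite uuE.
have q_ge0 x : 0 <= q x by rewrite addr_ge0// sqr_ge0.
rewrite L2dot_class (eq_cintegral uuE) /cintegral /= Rintegral_cst// mul0r.
rewrite ltcE /= eqxx /= lt_neqAle Rintegral_ge0// andbT; apply/eqP => q0.
apply: u0; rewrite -L2class0; apply/L2classP.
have : (\int[mu]_x `|(EFin \o q) x| = 0)%E.
  under eq_integral do rewrite /= ger0_norm//.
  by rewrite -[LHS]fineK -?/(Rintegral _ _ _) -?q0//; exact: integrable_fin_num.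
move/(ae_eq_integral_abs mu measurableT (measurable_int _ iq)).
apply: filterS => x /(_ I) /= [] /eqP.
rewrite paddr_eq0 ?sqr_ge0// !sqrf_eq0 => /andP[/eqP r0 /eqP i0].
by apply/eqP; rewrite eq_complex r0 i0 !eqxx.
Qed.

HB.instance Definition _ := isDotProduct.Build C L2 L2dot L2dot_gt0.

End ComplexL2.

Section CFC.
Context (R : realType) (H : lmodType R[i]) (dot : {dot H for conjC}).

Definition hnorm (f : H) : R := Num.sqrt (Re (dot f f)).

Definition bounded_operator (B : {linear H -> H}) : Prop :=
  exists M : R, forall f, hnorm (B f) <= M * hnorm f.

(* Unordered sum with value in [0, +oo]; I may be finite or empty. *)
Definition Parseval_frame (I : countType) (u : I -> H) : Prop :=
  forall f : H,
    (\esum_(n in [set: I]) (ComplexField.Normc.normc (dot f (u n)) ^+ 2)%:E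
      = (hnorm f ^+ 2)%:E)%E.

Definition CFC (I : countType) (u : I -> H) : Prop :=
  exists2 B : {linear H -> H}, bounded_operator B & Parseval_frame (B \o u).

(* Indexing by the disjoint sum keeps multiplicities. *)
Definition extends_to_CFC (I : countType) (u : I -> H) : Prop :=
  exists (J : countType) (h : J -> H),
    CFC (fun k : I + J => match k with inl n => u n | inr m => h m end).

End CFC.

Definition mutually_singular d (T : measurableType d) (R : realType)
    (mu nu : set T -> \bar R) : Prop :=
  exists A : set T, [/\ measurable A, mu A = 0%E & nu (~` A) = 0%E].

(* e^(i t), by Euler's formula *)
Definition expi (R : realType) (t : R) : R[i] := Complex (cos t) (sin t).

Section Exponentials.
Context (R : realType) (mu : {finite_measure set (measurableTypeR R) -> \bar R}).

Lemma bounded_Lfun2 (f : R -> R) : measurable_fun setT f ->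
  (forall x, `|f x| <= 1) -> f \in Lfun mu 2%:E.
Proof.
move=> mf f1; apply/andP; split; rewrite inE//=.
rewrite /finite_norm unlock poweR_lty//.
apply: (@le_lt_trans _ _ (\int[mu]_x (cst 1 x))%E).
  apply: ge0_le_integral => //=.
  - apply/measurable_EFinP.
    apply: (measurableT_comp (measurable_powR 2)).
    exact: (measurableT_comp (@normr_measurable R setT) mf).
  - by move=> x _; rewrite lee_fin powR_mulrn// expr_le1.
by rewrite integral_cst// mul1e ltey_eq fin_num_measure.
Qed.

Lemma expi_cLfun2 (n : nat) :
  (fun x : R => expi (2 * pi * n%:R * x)) \in @cLfun2 _ (measurableTypeR R) R mu.
Proof.
have mt : measurable_fun setT (fun x : R => 2 * pi * n%:R * x).
  exact: measurable_funM.
have mcos : measurable_fun setT (@cos R).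
  by apply: continuous_measurable_fun; exact: continuous_cos.
have msin : measurable_fun setT (@sin R).
  by apply: continuous_measurable_fun; exact: continuous_sin.
apply/andP; split; apply: bounded_Lfun2.
- exact: (measurableT_comp mcos mt).
- by move=> x; rewrite ler_norml cos_geN1 cos_le1.
- exact: (measurableT_comp msin mt).
- by move=> x; rewrite ler_norml sin_geN1 sin_le1.
Qed.

Definition expL2 (n : nat) : L2 mu := L2class (MkL2fun (expi_cLfun2 n)).

End Exponentials.

(* Main.v *)
Require Import Defs.
From mathcomp Require Import all_boot all_order all_algebra.
From mathcomp Require Import complex sesquilinear ring lra finmap.
From mathcomp Require Import all_classical all_reals all_analysis measurable_realfun.
Import Order.TTheory GRing.Theory Num.Def Num.Theory.
Import numFieldNormedType.Exports.
Import HBNNSimple.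

(** Write e(x) for exp(2 pi i x), H for L^2(mu), and suppose that B is bounded
    on H and that the vectors B e_n (n >= 0), with some others, form a Parseval
    frame.  A subfamily of a Parseval frame is a Bessel family with bound 1, so
      ||B p||^2 <= sum of the |p_i|^2   for every polynomial p in e(x),
    while boundedness gives ||B p|| <= M ||p||_H.  The first bound sees p in
    L^2 of Lebesgue measure, the second one sees it in L^2(mu); as mu is
    singular these norms are unrelated, and B is squeezed to zero.  Then every
    frame coefficient vanishes, whereas the constant 1 has norm 1.

    The heart is [peak_approx]: for every eps some polynomial Q satisfies
    sum |Q_i|^2 <= eps and ||1 - Q(e(x))||^2_H <= eps.  It is the elementary
    counterpart of the theorem of F. and M. Riesz, and is explicit.  As mu
    lives on a Lebesgue null set, all of its mass but eps lies in finitely many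
    intervals of small total length.  A multiple of a Fejer kernel is at least
    1 on a given short interval, is nonnegative everywhere, and has mean
    comparable to the length of the interval ([interval_peak]).  Adding these
    gives a polynomial P with Re P >= 0 on the unit circle, Re P >= N on the
    intervals, and P(0) small; Q is 1 - (1 - P/n)^n, a polynomial version of
    1 - exp(-P) ([small_poly_near_one]).  On the one hand
    |exp(-P)| <= 1 and its mean exp(-P(0)) is nearly 1, so exp(-P) is close to
    1 in L^2 of Lebesgue measure; on the other hand |exp(-P)| <= exp(-N) on the
    intervals.  Coefficients are bounded by values through Parseval's identity
    on the roots of unity ([coef_nsq_le]).

    Comparing e_m with e_m Q gives B e_m = 0 for m >= 0.  Since Q - Q(0) is
    divisible by e and is close to 1 in H, negative powers of e are limits of
    analytic polynomials, and B kills all trigonometric polynomials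
    ([kernel_trig]).  These are dense in L^2(mu): the sets whose indicator is
    approximable by [0,1]-valued trigonometric polynomials form a
    sigma-algebra, which contains the half lines up to null sets
    ([measurable_approximable]); simple functions and truncation do the rest
    ([vanishing_on_trig_eq0]). *)

Set Implicit Arguments.
Unset Strict Implicit.
Unset Printing Implicit Defensive.
Local Open Scope classical_set_scope.
Local Open Scope ring_scope.

Local Notation Re := complex.Re.
Local Notation Im := complex.Im.

(** * Squared modulus and polynomials on the unit circle *)

Section SquaredModulus.
Context {R : realType}.
Implicit Types z w : R[i].

(** The squared modulus with values in R, so that it can be integrated and
    compared without coercing from R[i]. *)
Definition nsq z : R := Re z ^+ 2 + Im z ^+ 2.

Lemma nsq_ge0 z : 0 <= nsq z.
Proof. by rewrite addr_ge0 ?sqr_ge0. Qed.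

Lemma nsqM z w : nsq (z * w) = nsq z * nsq w.
Proof. by case: z => a b; case: w => c d; rewrite /nsq /=; ring. Qed.

Lemma nsq1 : nsq 1 = 1.
Proof. by rewrite /nsq /= expr1n expr0n addr0. Qed.

Lemma nsqX z n : nsq (z ^+ n) = nsq z ^+ n.
Proof. by elim: n => [|n ih]; rewrite ?expr0 ?nsq1 // !exprS nsqM ih. Qed.

Lemma nsq_real (r : R) : nsq (r%:C)%C = r ^+ 2.
Proof. by rewrite /nsq /= expr0n addr0. Qed.

Lemma nsqN z : nsq (- z) = nsq z.
Proof. by case: z => a b; rewrite /nsq /= !sqrrN. Qed.

Lemma nsq_conj z : nsq z^*%C = nsq z.
Proof. by case: z => a b; rewrite /nsq /= sqrrN. Qed.

Lemma nsqD_le z w : nsq (z + w) <= 2 * nsq z + 2 * nsq w.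
Proof.
case: z => a b; case: w => c d; rewrite /nsq /=.
rewrite -subr_ge0 (_ : _ - _ = (a - c) ^+ 2 + (b - d) ^+ 2); last by ring.
by rewrite addr_ge0 ?sqr_ge0.
Qed.

Lemma Re_sqr_le_nsq z : Re z ^+ 2 <= nsq z.
Proof. by rewrite lerDl sqr_ge0. Qed.

Lemma mulz_conj z : z * z^*%C = ((nsq z)%:C)%C.
Proof.
case: z => a b; apply/eqP; rewrite eq_complex /nsq /=.
by apply/andP; split; apply/eqP; ring.
Qed.

Lemma nsq_normc z : ComplexField.Normc.normc z ^+ 2 = nsq z.
Proof. by case: z => a b; rewrite /nsq /= sqr_sqrtr// addr_ge0 ?sqr_ge0. Qed.

(** Peeling off the coefficients one by one gives an explicit bound. *)
Lemma horner_circle_bounded (p : {poly R[i]}) :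
  exists2 M : R, 0 <= M & forall z, nsq z = 1 -> nsq p.[z] <= M.
Proof.
elim/poly_ind: p => [|p c [M M0 hM]].
  by exists 0 => // z _; rewrite horner0 /nsq /= expr0n addr0.
exists (2 * M + 2 * nsq c); first by rewrite addr_ge0 ?mulr_ge0 ?nsq_ge0.
move=> z z1; rewrite hornerMXaddC; apply: (le_trans (nsqD_le _ _)).
by rewrite lerD2r ler_pM2l// nsqM z1 mulr1 hM.
Qed.

Lemma sum_Re (I : Type) (r : seq I) (P : pred I) (F : I -> R[i]) :
  Re (\sum_(i <- r | P i) F i) = \sum_(i <- r | P i) Re (F i).
Proof.
by apply: (big_morph (@complex.Re R)) => // -[a b] [c d].
Qed.

Lemma Re_conjc z : Re z^*%C = Re z. Proof. by case: z. Qed.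

Lemma ReD z w : Re (z + w) = Re z + Re w.
Proof. by case: z => a b; case: w. Qed.

End SquaredModulus.

Section Circle.
Context {R : realType}.
Implicit Types (w z : R[i]) (x y t : R).

Lemma conj_unit w : nsq w = 1 -> w^*%C = w^-1.
Proof.
move=> w1; have ww : w * w^*%C = 1 by rewrite mulz_conj w1.
have w0 : w != 0.
  by apply/eqP => w0; move: ww; rewrite w0 mul0r => /esym/eqP; rewrite oner_eq0.
by apply: (mulfI w0); rewrite ww divff.
Qed.

Definition ecirc x : R[i] := expi (2 * pi * x).

Lemma nsq_ecirc x : nsq (ecirc x) = 1.
Proof. by rewrite /nsq /= cos2Dsin2. Qed.

Lemma expiD t y : expi (t + y) = expi t * expi y.
Proof.
apply/eqP; rewrite eq_complex /= cosD sinD eqxx /=.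
by apply/eqP; ring.
Qed.

Lemma expi0 : expi (0 : R) = 1.
Proof. by rewrite /expi cos0 sin0. Qed.

Lemma expiN t : expi (- t) = (expi t)^*%C.
Proof. by rewrite /expi cosN sinN. Qed.

Lemma expiMn t n : expi (n%:R * t) = expi t ^+ n.
Proof.
elim: n => [|n ih]; first by rewrite mul0r expr0 expi0.
by rewrite exprS -ih -expiD; congr expi; rewrite -natr1; ring.
Qed.

Lemma ecirc_exp n x : expi (2 * pi * n%:R * x) = ecirc x ^+ n.
Proof. by rewrite -expiMn; congr expi; ring. Qed.

Lemma ecircB x y : ecirc (x - y) = ecirc x * (ecirc y)^*%C.
Proof. by rewrite -expiN -expiD; congr expi; ring. Qed.

(** A geometric sum of ratio w^k <> 1 with (w^k)^n = 1; the ratio differs from 1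
    because sin (pi k / n) > 0. *)
Lemma sum_roots_unity n k : (0 < k < n)%N ->
  \sum_(j < n) (ecirc (n%:R^-1) ^+ j) ^+ k = 0.
Proof.
move=> /andP[k0 kn]; set w := ecirc _.
have n0 : (0 < n)%N by exact: leq_trans kn.
have wn : w ^+ n = 1.
  rewrite /w /ecirc -expiMn mulrCA divff ?mulr1 ?pnatr_eq0 -?lt0n//.
  by rewrite /expi mulr_natl cos2pi sin2pi.
have wk : w ^+ k != 1.
  rewrite /w /ecirc -expiMn; apply/eqP => /(congr1 (@complex.Re R)) /= c1.
  have : 0 < sin (pi * (k%:R / n%:R)) :> R.
    apply: sin_gt0_pi; rewrite mulr_gt0 ?pi_gt0 ?divr_gt0 ?ltr0n//=.
    by rewrite -[ltRHS]mulr1 ltr_pM2l ?pi_gt0// ltr_pdivrMr ?ltr0n// mul1r ltr_nat.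
  suff /eqP -> : sin (pi * (k%:R / n%:R)) == 0 :> R by rewrite ltxx.
  rewrite -sqrf_eq0 sin2cos2; apply/eqP.
  have := cos_mulr2n (pi * (k%:R / n%:R) : R).
  have -> : pi * (k%:R / n%:R) *+ 2 = k%:R * (2 * pi / n%:R) :> R.
    by rewrite -mulr_natr; ring.
  rewrite c1 => h; lra.
have : (w ^+ k - 1) * \sum_(j < n) (w ^+ k) ^+ j = 0.
  by rewrite -subrX1 exprAC wn expr1n subrr.
move/eqP; rewrite mulf_eq0 subr_eq0 (negbTE wk) /= => /eqP s0.
by rewrite -[RHS]s0; apply: eq_bigr => j _; rewrite exprAC.
Qed.

(** Averaging |p|^2 over the n-th roots of unity gives the sum of the squared
    coefficients as soon as n exceeds the degree: the cross terms are the
    vanishing sums of [sum_roots_unity].  This replaces Parseval's identity for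
    Lebesgue measure on the circle. *)
Lemma coef_nsq_le (p : {poly R[i]}) (s : R) n : (size p <= n)%N ->
  (forall z, nsq z = 1 -> nsq p.[z] <= s) -> \sum_(i < n) nsq p`_i <= s.
Proof.
case: n => [|n'] sp hs.
  rewrite big_ord0; apply: le_trans (hs 1 nsq1); exact: nsq_ge0.
set n := n'.+1 in sp *.
pose w := ecirc (n%:R^-1 : R).
have w1 j : nsq (w ^+ j) = 1 by rewrite nsqX nsq_ecirc expr1n.
have w0 : w != 0.
  by apply/eqP => w0; move: (nsq_ecirc (n%:R^-1 : R)); rewrite -/w w0 /nsq /=
    expr0n addr0 => /esym/eqP; rewrite oner_eq0.
(* expand the square and sum over j first *)
have key : \sum_(j < n) nsq p.[w ^+ j] = n%:R * \sum_(i < n) nsq p`_i.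
  apply: (@complexI R); rewrite rmorphM rmorph_nat !rmorph_sum /=.
  transitivity (\sum_(j < n) \sum_(i < n) \sum_(k < n)
      (p`_i * (p`_k)^*%C) * (w ^+ j) ^+ i * (w ^- j) ^+ k).
    apply: eq_bigr => j _; rewrite -mulz_conj (horner_coef_wide _ sp).
    rewrite rmorph_sum mulr_suml; apply: eq_bigr => i _.
    rewrite mulr_sumr; apply: eq_bigr => k _ /=.
    by rewrite rmorphM rmorphXn /= (conj_unit (w1 j)); ring.
  rewrite exchange_big mulr_sumr /=; apply: eq_bigr => i _.
  rewrite exchange_big /= (bigD1 i)//= [X in _ + X]big1 ?addr0.
    rewrite (eq_bigr (fun=> ((nsq p`_i)%:C)%C)).
      by rewrite sumr_const card_ord mulr_natl.
    move=> j _; rewrite -mulrA -exprMn divff ?expr1n ?mulr1 ?mulz_conj//.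
    by rewrite expf_neq0.
  move=> k ki; under eq_bigr do rewrite -mulrA.
  rewrite -mulr_sumr.
  suff -> : \sum_(j < n) (w ^+ j) ^+ i * (w ^- j) ^+ k = 0 by rewrite mulr0.
  case: (ltngtP i k) => [ik|ik|/val_inj ik]; last by rewrite ik eqxx in ki.
  - have := @sum_roots_unity n (k - i)%N.
    rewrite subn_gt0 ik (leq_ltn_trans (leq_subr _ _) (ltn_ord k)) => /(_ isT).
    move/(congr1 (fun z => z^*%C)); rewrite rmorph0 rmorph_sum /= => s0.
    rewrite -[RHS]s0; apply: eq_bigr => j _; rewrite rmorphXn /= (conj_unit (w1 j)).
    rewrite -{1}(subnKC (ltnW ik)) exprD mulrA -exprMn divff ?expr1n ?mul1r//.
    by rewrite expf_neq0.
  - have := @sum_roots_unity n (i - k)%N.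
    rewrite subn_gt0 ik (leq_ltn_trans (leq_subr _ _) (ltn_ord i)) => /(_ isT) s0.
    rewrite -[RHS]s0; apply: eq_bigr => j _.
    rewrite -{1}(subnK (ltnW ik)) exprD -mulrA -exprMn divff ?expr1n ?mulr1//.
    by rewrite expf_neq0.
rewrite -(@ler_pM2l _ n%:R) ?ltr0n// -key mulr_natl -[n in _ *+ n]card_ord.
by rewrite -sumr_const; apply: ler_sum => j _; exact: hs.
Qed.

(** The analytic polynomial whose real part on the unit circle is n times the
    n-th Fejer kernel, written as the sum of the analytic completions of the
    Dirichlet kernels. *)
Definition fejer n : {poly R[i]} :=
  \sum_(m < n) (1 + (\sum_(k < m) 'X^(k.+1)) *+ 2).

(** The classical formula for the Fejer kernel; it makes the positivity of
    Re (fejer n) on the circle visible. *)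
Lemma fejerE n w : nsq w = 1 ->
  Re (fejer n).[w] = nsq (\sum_(k < n) w ^+ k).
Proof.
move=> w1; rewrite /fejer; elim: n => [|n ih].
  by rewrite !big_ord0 horner0 /nsq /= expr0n addr0.
rewrite !big_ord_recr /= hornerD ReD ih.
set D := \sum_(k < n) w ^+ k.
have -> : (1 + (\sum_(k < n) 'X^(k.+1)) *+ 2 : {poly R[i]}).[w] =
    1 + (w ^+ n * D^*%C) *+ 2.
  rewrite hornerD hornerC hornerMn horner_sum; congr (1 + _ *+ 2).
  rewrite /D rmorph_sum mulr_sumr (reindex_inj rev_ord_inj) /=.
  apply: eq_bigr => k _; rewrite hornerXn rmorphXn /= (conj_unit w1) exprVn.
  have kn := ltn_ord k; rewrite -subSn// subSS.
  have -> : w ^+ n = w ^+ (n - k) * w ^+ k by rewrite -exprD subnK// ltnW.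
  rewrite mulfK// expf_neq0//.
  by apply/eqP => w0; move: w1; rewrite w0 /nsq /= expr0n addr0 => /esym/eqP;
    rewrite oner_eq0.
have : nsq (w ^+ n) = 1 by rewrite nsqX w1 expr1n.
case: (w ^+ n) => a b; case: D => c d; rewrite /nsq /= => h.
lra.
Qed.

Lemma fejer_coef0 n : (fejer n).[0] = n%:R.
Proof.
rewrite /fejer horner_sum (eq_bigr (fun=> 1)) => [|m _].
  by rewrite sumr_const card_ord.
rewrite hornerD hornerC hornerMn horner_sum big1 ?mul0rn ?addr0// => k _.
by rewrite hornerXn expr0n.
Qed.

End Circle.

(** * Polynomials that peak on short intervals *)

Section PeakPolynomials.
Context {R : realType}.

(** Cheap bound from cos (2t) = 2 cos^2 t - 1 >= 0. *)
Lemma cos_ge_half (t : R) : 0 <= t <= pi / 4 -> 2^-1 <= cos t.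
Proof.
move=> /andP[t0 t1]; have p0 := pi_gt0 R.
have c0 : 0 <= cos t by apply: cos_ge0_pihalf; lra.
have c2 : 0 <= cos (t *+ 2) by apply: cos_ge0_pihalf; rewrite (mulr2n t); lra.
rewrite cos_mulr2n in c2; rewrite leNgt; apply/negP => h.
have : cos t ^+ 2 <= 2^-1 * cos t by rewrite expr2 ler_wpM2r// ltW.
move=> h2; lra.
Qed.

Lemma bernoulli_ineq (x : R) n : -1 <= x -> 1 + n%:R * x <= (1 + x) ^+ n.
Proof.
move=> x1; have x10 : 0 <= 1 + x by lra.
elim: n => [|n ih]; first by rewrite mul0r addr0 expr0.
rewrite exprS; apply: (@le_trans _ _ ((1 + x) * (1 + n%:R * x))).
  rewrite -(natr1 n) -subr_ge0 (_ : _ - _ = n%:R * x ^+ 2); last by ring.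
  by rewrite mulr_ge0 ?sqr_ge0.
by rewrite ler_wpM2l.
Qed.

(** All terms point in nearly the same direction, as the angles stay in
    [0, pi/4]. *)
Lemma fejer_peak n (t : R) : 0 <= t -> n%:R * t <= 8^-1 ->
  n%:R / 2 <= Re (\sum_(k < n) ecirc t ^+ k).
Proof.
move=> t0 nt; rewrite sum_Re -[n in n%:R]card_ord -sumr_const mulr_suml.
apply: ler_sum => k _; rewrite div1r /ecirc -expiMn /=.
have p0 := pi_gt0 R.
have kt : k%:R * t <= 8^-1.
  by apply: le_trans nt; rewrite ler_wpM2r// ler_nat ltnW.
have kt0 : 0 <= k%:R * t by rewrite mulr_ge0.
apply: cos_ge_half; rewrite (_ : k%:R * _ = pi * (2 * (k%:R * t))); last by ring.
rewrite mulr_ge0 ?mulr_ge0 ?pi_ge0//= ler_pM2l//; lra.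
Qed.

(** P is a rotated Fejer polynomial scaled by 4 / n^2, where n is the integer
    part of 1 / (8 (b - a)): up to frequency n the characters do not have time
    to turn on the interval.  The real part is then at least
    (4 / n^2) (n / 2)^2 = 1 there, and the mean P(0) is
    4 / n <= 64 (b - a). *)
Lemma interval_peak (a b : R) : b - a <= 8^-1 -> exists P : {poly R[i]}, exists c : R,
  [/\ P.[0] = (c%:C)%C, 0 <= c <= 64 * Num.max 0 (b - a),
      forall z, nsq z = 1 -> 0 <= Re P.[z] &
      forall x, a < x <= b -> 1 <= Re P.[ecirc x]].
Proof.
move=> ba8; have [ba|ab] := leP b a.
  exists 0, 0; split.
  - by rewrite horner0.
  - by rewrite lexx mulr_ge0// le_max lexx.
  - by move=> z _; rewrite horner0.
  - by move=> x /andP[ax xb]; have := lt_le_trans ax xb; rewrite ltNge ba.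
have [l lE] : exists l, l = b - a by exists (b - a).
have l0 : 0 < l by rewrite lE subr_gt0.
rewrite -lE in ba8 *.
pose n := Num.truncn ((8 * l)^-1).
have /andP[n1 n2] : n%:R <= (8 * l)^-1 < n.+1%:R.
  by apply: truncn_itv; rewrite invr_ge0 mulr_ge0// ltW.
have n0 : (0 < n)%N.
  rewrite -(@ltr_nat R); rewrite -(natr1 n) in n2.
  have : 1 <= (8 * l)^-1.
    rewrite -[leLHS]invr1 lef_pV2 ?posrE ?mulr_gt0//; lra.
  move=> h; have : (0 : R) < n%:R by lra.
  by [].
have nl : n%:R * l <= 8^-1.
  by rewrite -ler_pdivlMr// -invfM.
have nR : 0 < n%:R :> R by rewrite ltr0n.
have nl16 : n%:R^-1 <= 16 * l.
  have h : 1 <= n.+1%:R * (8 * l).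
    by rewrite -ler_pdivrMr ?mulr_gt0// div1r ltW.
  have n11 : 1 <= n%:R :> R by rewrite ler1n.
  rewrite -(@ler_pM2l _ n%:R)// divff ?gt_eqF//; apply: (le_trans h).
  rewrite -(natr1 n); have : l <= n%:R * l by rewrite ler_peMl// ltW.
  move=> ?; lra.
pose u : R[i] := (ecirc a)^*%C.
have u1 : nsq u = 1 by rewrite nsq_conj nsq_ecirc.
pose P := (((4 / n%:R ^+ 2)%:C)%C) *: (fejer n \Po (u *: 'X)).
have PE z : P.[z] = ((4 / n%:R ^+ 2)%:C)%C * (fejer n).[u * z].
  by rewrite /P hornerZ horner_comp hornerZ hornerX.
have k0 : 0 < 4 / n%:R ^+ 2 :> R by rewrite divr_gt0// exprn_gt0.
have RePE z : nsq z = 1 ->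
    Re P.[z] = 4 / n%:R ^+ 2 * nsq (\sum_(k < n) (u * z) ^+ k).
  move=> z1; rewrite PE -fejerE ?nsqM ?u1 ?z1 ?mulr1//.
  by case: (_.[_]) => ? ? /=; rewrite mul0r subr0.
exists P, (4 / n%:R); split.
- rewrite PE mulr0 fejer_coef0 -[X in _ * X](rmorph_nat (real_complex R)).
  rewrite -rmorphM /=; congr (_%:C)%C; rewrite expr2 invfM mulrA divfK ?gt_eqF//.
- rewrite divr_ge0//= (max_r (ltW l0)).
  have -> : 64 * l = 4 * (16 * l) by ring.
  by rewrite ler_pM2l.
- by move=> z z1; rewrite RePE// mulr_ge0 ?nsq_ge0// ltW.
- move=> x /andP[ax xb]; rewrite RePE ?nsq_ecirc//.
  rewrite [u * _]mulrC -ecircB.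
  have hx : n%:R * (x - a) <= 8^-1.
    by apply: le_trans nl; rewrite ler_pM2l// lE lerD2r.
  have ReD : n%:R / 2 <= Re (\sum_(k < n) ecirc (x - a) ^+ k).
    by apply: fejer_peak hx; rewrite subr_ge0 ltW.
  apply: (@le_trans _ _ (4 / n%:R ^+ 2 * (n%:R / 2) ^+ 2)).
    by rewrite (_ : _ * _ = 1)//; field; rewrite gt_eqF.
  rewrite ler_pM2l//; apply: le_trans (Re_sqr_le_nsq _).
  by rewrite ler_sqr ?nnegrE// ?divr_ge0//; apply: le_trans ReD; rewrite divr_ge0.
Qed.

(** With S = (1 - P/n)^n and u = Re P, one has |1 - P/n|^2 =
    1 - 2u/n + |P|^2/n^2, hence |S|^2 <= exp (delta - 2u) when n is large.  So
    1 - S = Q is close to 1 where u is large.  On the other hand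
    sum |Q_i|^2 = sum |S_i|^2 + 1 - 2 Re S_0, where the first sum is at most
    exp delta because u >= 0, and S_0 >= 1 - c by Bernoulli's inequality. *)
Lemma small_poly_near_one (P : {poly R[i]}) (c delta : R) :
  P.[0] = (c%:C)%C -> 0 <= c -> 0 < delta ->
  (forall z, nsq z = 1 -> 0 <= Re P.[z]) ->
  exists Q : {poly R[i]},
    \sum_(i < size Q) nsq Q`_i <= expR delta - 1 + 2 * c /\
    forall z, nsq z = 1 -> nsq (1 - Q.[z]) <= expR (delta - 2 * Re P.[z]).
Proof.
move=> P0 c0 d0 ReP; have [H H0 hH] := horner_circle_bounded P.
(* n >= c makes 1 - c/n nonnegative, n >= H/delta makes |P|^2/n <= delta *)
pose n := (Num.truncn (c + H / delta)).+1.
have cHd : c + H / delta < n%:R by exact: truncnS_gt.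
have nR : 0 < n%:R :> R by rewrite ltr0n.
have Hd0 : 0 <= H / delta by rewrite divr_ge0// ltW.
have cn : c / n%:R <= 1 by rewrite ler_pdivrMr// mul1r; lra.
have Hn : H / n%:R <= delta.
  by rewrite ler_pdivrMr// -ler_pdivrMl// [_^-1 * _]mulrC; lra.
pose S : {poly R[i]} := (1 - ((n%:R^-1)%:C)%C *: P) ^+ n.
have S_le z : nsq z = 1 -> nsq S.[z] <= expR (delta - 2 * Re P.[z]).
  move=> z1; rewrite /S horner_exp nsqX hornerD hornerN hornerC hornerZ.
  have := hH z z1; case: (P.[z]) => u v /= huv.
  apply: (@le_trans _ _ (expR (n%:R^-1 * (delta - 2 * u)) ^+ n)).
    rewrite ler_pXn2r ?nnegrE ?nsq_ge0 ?expR_ge0//.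
    apply: le_trans (expR_ge1Dx _); rewrite /nsq /=.
    rewrite (_ : _ + _ = 1 + n%:R^-1 * (nsq (Complex u v) / n%:R - 2 * u)).
      rewrite lerD2l ler_pM2l ?invr_gt0// lerD2r; apply: le_trans Hn.
      by rewrite ler_pM2r ?invr_gt0.
    by rewrite /nsq /=; ring.
  by rewrite -expRM_natl mulVKf// gt_eqF.
exists (1 - S); split=> [|z z1]; last first.
  by rewrite hornerD hornerN hornerC subKr; exact: S_le.
(* a common number of coefficients for Q and S, nonzero to isolate index 0 *)
set Q := 1 - S; pose m := (size Q + size S).+1.
apply: (@le_trans _ _ (\sum_(i < m) nsq Q`_i)).
  rewrite (big_ord_widen m (fun i => nsq Q`_i)); last first.
    by rewrite /m ltnW// ltnS leq_addr.
  rewrite big_mkcond /=; apply: ler_sum => i _.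
  by case: ifP => // _; exact: nsq_ge0.
have S0 : 1 - c <= Re S`_0.
  rewrite -horner_coef0 /S horner_exp hornerD hornerN hornerC hornerZ P0.
  rewrite -rmorphM -(rmorph1 (real_complex R)) -rmorphB -rmorphXn /=.
  apply: le_trans (bernoulli_ineq n _); first by rewrite mulrN mulVKf// gt_eqF.
  by rewrite lerN2 mulrC.
have : \sum_(i < m) nsq S`_i <= expR delta.
  apply: coef_nsq_le => [|z z1]; first by rewrite /m ltnW// ltnS leq_addl.
  apply: (le_trans (S_le z z1)); rewrite ler_expR.
  by have := ReP z z1; lra.
rewrite /m !big_ord_recl.
rewrite [X in _ -> _ + X <= _](eq_bigr (fun i : 'I__ => nsq S`_(lift ord0 i))).
  rewrite /Q coefB coef1 /=; move: S0; case: (S`_0) => a b /=.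
  rewrite /nsq /=; set s := \sum_(i < _) _; move=> h1 h2.
  lra.
by move=> i _; rewrite /Q coefB coef1 /= sub0r nsqN.
Qed.

End PeakPolynomials.

(** * Bounded measurable functions in the complex L^2 space *)

Section BoundedMeasurable.
Context {R : realType}.
Local Notation T := (measurableTypeR R).
Implicit Types f g : T -> R[i].

(** A class of functions that is stable under the ring operations, unlike the
    square integrable ones, and that a finite measure puts in L^2. *)
Record bmeas f : Prop := BMeas {
  bmeas_Re : measurable_fun setT (fun x => Re (f x)) ;
  bmeas_Im : measurable_fun setT (fun x => Im (f x)) ;
  bmeas_bounded : exists M : R, forall x, nsq (f x) <= M }.

Lemma bmeas_cst (c : R[i]) : bmeas (fun=> c).
Proof. by split; [exact: measurable_cst..|exists (nsq c)]. Qed.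

Lemma bmeasD f g : bmeas f -> bmeas g -> bmeas (fun x => f x + g x).
Proof.
move=> [f1 f2 [M fM]] [g1 g2 [N gN]]; split.
- rewrite (_ : (fun _ => _) = (fun x => Re (f x) + Re (g x))).
    exact: measurable_funD.
  by apply/funext => x; rewrite ReD.
- rewrite (_ : (fun _ => _) = (fun x => Im (f x) + Im (g x))).
    exact: measurable_funD.
  by apply/funext => x; case: (f x) => ? ?; case: (g x).
- exists (2 * M + 2 * N) => x; apply: (le_trans (nsqD_le _ _)).
  by rewrite lerD// ler_pM2l.
Qed.

Lemma bmeasM f g : bmeas f -> bmeas g -> bmeas (fun x => f x * g x).
Proof.
move=> [f1 f2 [M fM]] [g1 g2 [N gN]]; split.
- rewrite (_ : (fun _ => _) =
      (fun x => Re (f x) * Re (g x) - Im (f x) * Im (g x))).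
    by apply: measurable_funB; exact: measurable_funM.
  by apply/funext => x; case: (f x) => ? ?; case: (g x).
- rewrite (_ : (fun _ => _) =
      (fun x => Re (f x) * Im (g x) + Im (f x) * Re (g x))).
    by apply: measurable_funD; exact: measurable_funM.
  by apply/funext => x; case: (f x) => ? ?; case: (g x).
- by exists (M * N) => x; rewrite nsqM ler_pM ?nsq_ge0.
Qed.

Lemma bmeasN f : bmeas f -> bmeas (fun x => - f x).
Proof.
move=> bf; rewrite (_ : (fun _ => _) = (fun x => (-1) * f x)).
  exact: bmeasM (bmeas_cst _) bf.
by apply/funext => x; rewrite mulN1r.
Qed.

Lemma bmeasB f g : bmeas f -> bmeas g -> bmeas (fun x => f x - g x).
Proof. by move=> bf /bmeasN; exact: bmeasD. Qed.

Lemma bmeas_conj f : bmeas f -> bmeas (fun x => (f x)^*%C).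
Proof.
move=> [f1 f2 [M fM]]; split.
- by under eq_fun do rewrite Re_conjc.
- rewrite (_ : (fun _ => _) = (fun x => - Im (f x))).
    exact: measurable_funN.
  by apply/funext => x; case: (f x).
- by exists M => x; rewrite nsq_conj.
Qed.

Lemma bmeasX f n : bmeas f -> bmeas (fun x => f x ^+ n).
Proof.
move=> bf; elim: n => [|n ih]; first exact: bmeas_cst.
rewrite (_ : (fun _ => _) = (fun x => f x * f x ^+ n)); first exact: bmeasM.
by apply/funext => x; rewrite exprS.
Qed.

Lemma bmeas_horner (p : {poly R[i]}) f : bmeas f -> bmeas (fun x => p.[f x]).
Proof.
move=> bf; elim/poly_ind: p => [|p c ih].
  by under eq_fun do rewrite horner0; exact: bmeas_cst.
under eq_fun do rewrite hornerMXaddC.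
by apply: bmeasD; [exact: bmeasM|exact: bmeas_cst].
Qed.

Lemma bmeas_ecirc : bmeas ecirc.
Proof.
have mt : measurable_fun (setT : set T) (fun x : T => 2 * pi * x).
  exact: measurable_funM.
split.
- by apply: measurableT_comp mt; apply: continuous_measurable_fun; exact: continuous_cos.
- by apply: measurableT_comp mt; apply: continuous_measurable_fun; exact: continuous_sin.
- by exists 1 => x; rewrite nsq_ecirc.
Qed.

Lemma bmeas_real (r : T -> R) : measurable_fun setT r ->
  (forall x, 0 <= r x <= 1) -> bmeas (fun x => (r x)%:C%C).
Proof.
move=> mr r01; split; [exact: mr|exact: measurable_cst|].
exists 1 => x; rewrite nsq_real; have /andP[r0 r1] := r01 x.
by rewrite expr_le1.
Qed.

Lemma measurable_nsq f : measurable_fun setT (fun x => Re (f x)) ->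
  measurable_fun setT (fun x => Im (f x)) ->
  measurable_fun setT (fun x => (nsq (f x))%:E).
Proof.
move=> f1 f2; apply/measurable_EFinP; rewrite /nsq.
by apply: measurable_funD; apply: measurable_funX.
Qed.

End BoundedMeasurable.

Section SquareIntegrable.
Context {R : realType} (mu : {finite_measure set (measurableTypeR R) -> \bar R}).
Local Notation T := (measurableTypeR R).
Implicit Types f g : T -> R[i].

Lemma bounded_Lfun2_scale (h : T -> R) (M : R) : measurable_fun setT h ->
  (forall x, h x ^+ 2 <= M) -> h \in Lfun mu 2%:E.
Proof.
move=> mh hM; pose K := M + 1.
have M0 : 0 <= M by apply: le_trans (hM 0); exact: sqr_ge0.
have K0 : 0 < K by rewrite ltr_wpDl.
have l2 : (1 <= 2%:E :> \bar R)%E by rewrite lee_fin ler1n.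
have [L0 LD] := Lfun_submod_closed mu l2.
rewrite (_ : h = K *: (fun x => K^-1 * h x) + 0).
  apply: LD L0; apply: bounded_Lfun2; first exact: measurable_funM.
  move=> x; rewrite -ler_sqr ?nnegrE// real_normK ?num_real//.
  rewrite expr1n exprMn exprVn ler_pdivrMl ?exprn_gt0// mulr1.
  apply: (le_trans (hM x)); rewrite /K sqrrD1 mulr2n.
  have := sqr_ge0 M; lra.
apply/funext => x; rewrite addr0.
by rewrite -[RHS]/(K * (K^-1 * h x)) mulVKf// gt_eqF.
Qed.

Lemma bmeas_cLfun2 f : bmeas f -> f \in cLfun2 mu.
Proof.
move=> [f1 f2 [M fM]]; apply/andP; split; apply: (@bounded_Lfun2_scale _ M) => // x;
  apply: le_trans (fM x).
- exact: Re_sqr_le_nsq.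
- by rewrite /nsq lerDr sqr_ge0.
Qed.

(** The class of f in L^2(mu), made total by the junk value 0 outside L^2, so
    that no membership proof occurs in the term. *)
Definition cl f : L2 mu := L2class (insubd 0 f).

Lemma clE f (Lf : f \in cLfun2 mu) : cl f = L2class (MkL2fun Lf).
Proof. by rewrite /cl /insubd insubT. Qed.

Lemma clD f g : f \in cLfun2 mu -> g \in cLfun2 mu ->
  cl (fun x => f x + g x) = cl f + cl g.
Proof.
move=> Lf Lg; have Lfg : (fun x => f x + g x) \in cLfun2 mu := rpredD Lf Lg.
by rewrite !clE -L2classD; congr L2class; apply: val_inj.
Qed.

Lemma clZ (a : R[i]) f : f \in cLfun2 mu -> cl (fun x => a * f x) = a *: cl f.
Proof.
move=> Lf; have Laf : (fun x => a * f x) \in cLfun2 mu := rpredZ a Lf.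
by rewrite !clE -L2classZ; congr L2class; apply: val_inj.
Qed.

Lemma clB f g : f \in cLfun2 mu -> g \in cLfun2 mu ->
  cl (fun x => f x - g x) = cl f - cl g.
Proof.
move=> Lf Lg; rewrite -[- cl g]scaleN1r -clZ// -clD//; last exact: rpredZ.
by congr cl; apply/funext => x; rewrite mulN1r.
Qed.

Lemma cl_expL2 n : expL2 mu n = cl (fun x => ecirc x ^+ n).
Proof.
rewrite /expL2 -clE; congr cl; apply/funext => x; exact: ecirc_exp.
Qed.

Lemma cl_repr (F : L2 mu) : exists2 f, f \in cLfun2 mu & F = cl f.
Proof.
have Lf := valP (repr F); exists (repr F) => //.
rewrite (clE Lf); transitivity (L2class (repr F)); first by rewrite L2reprK.
by congr L2class; apply: val_inj.
Qed.

(** The squared norm of L^2(mu). *)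
Definition N2 (F : L2 mu) : R := Re (L2dot F F).

Lemma N2_cl f : f \in cLfun2 mu ->
  ((N2 (cl f))%:E = \int[mu]_x (nsq (f x))%:E)%E.
Proof.
move=> Lf; rewrite clE /N2 L2dot_class /cintegral /=.
have [iq _] := L2fun_mul_integrable (MkL2fun Lf) (MkL2fun Lf).
rewrite /Rintegral fineK; last exact: integrable_fin_num.
by apply: eq_integral => x _ /=; rewrite -[_^*]/(_^*%C) mulz_conj.
Qed.

Lemma cLfun2_measurable_nsq (f : T -> R[i]) : f \in cLfun2 mu ->
  measurable_fun setT (fun x => (nsq (f x))%:E).
Proof.
move=> /andP[/andP[+ _] /andP[+ _]]; rewrite !inE /= => *.
exact: measurable_nsq.
Qed.

Lemma N2_ge0 F : 0 <= N2 F.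
Proof.
have [f Lf ->] := cl_repr F; rewrite -lee_fin N2_cl//.
by apply: integral_ge0 => x _; rewrite lee_fin nsq_ge0.
Qed.

Lemma N2_eq0 F : N2 F = 0 -> F = 0.
Proof.
move=> F0; apply/eqP; apply/negPn/negP => /(@L2dot_gt0 _ _ _ mu).
by move: F0; rewrite /N2 ltcE => ->; rewrite ltxx andbF.
Qed.

(** A substitute for the triangle inequality that stays with squared norms;
    the constant 2 is harmless in all approximation arguments. *)
Lemma N2D_le F G : N2 (F + G) <= 2 * N2 F + 2 * N2 G.
Proof.
have [f Lf ->] := cl_repr F; have [g Lg ->] := cl_repr G.
have Lfg : (fun x => f x + g x) \in cLfun2 mu := rpredD Lf Lg.
have m := cLfun2_measurable_nsq.
rewrite -clD// -lee_fin N2_cl// EFinD !EFinM !N2_cl//.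
rewrite -!ge0_integralZl//; [|by [exact: m|move=> *; rewrite lee_fin nsq_ge0]..].
rewrite -ge0_integralD//; last 4 first.
- by move=> *; rewrite mule_ge0// lee_fin nsq_ge0.
- by apply: measurable_funeM; exact: m.
- by move=> *; rewrite mule_ge0// lee_fin nsq_ge0.
- by apply: measurable_funeM; exact: m.
apply: ge0_le_integral => //.
- by move=> *; rewrite lee_fin nsq_ge0.
- exact: m.
- by apply: emeasurable_funD; apply: measurable_funeM; exact: m.
- by move=> x _; rewrite -!EFinM -EFinD lee_fin nsqD_le.
Qed.

End SquareIntegrable.

(** * Synthesis bound for Parseval frames, and Lebesgue null sets *)

Section Bessel.
Context {R : realType} (H : lmodType R[i]) (dot : {dot H for conjC}).

Lemma hnorm_sqr (f : H) : hnorm dot f ^+ 2 = Re (dot f f).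
Proof.
rewrite /hnorm sqr_sqrtr//; have [->|f0] := eqVneq f 0.
  by rewrite linear0l.
by move: f0; rewrite -(dnorm_gt0 dot) ltcE /= => /andP[_ /ltW].
Qed.

(** Duality between analysis and synthesis: for F = sum a_i v_(s i), writing
    ||F||^2 as the sum of the conj a_i <F, v_(s i)> and using
    2 Re (conj a d) <= |a|^2 + |d|^2 gives
    2 ||F||^2 <= sum |a_i|^2 + sum |<F, v_(s i)>|^2, and the last sum is at most
    ||F||^2 because it is a part of the Parseval sum. *)
Lemma Parseval_synthesis_le (I : countType) (v : I -> H) n (s : 'I_n -> I)
    (a : 'I_n -> R[i]) : Parseval_frame dot v -> injective s ->
  hnorm dot (\sum_(i < n) a i *: v (s i)) ^+ 2 <= \sum_(i < n) nsq (a i).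
Proof.
move=> pv injs; set F := \sum_(i < n) _.
have bes : \sum_(i < n) nsq (dot F (v (s i))) <= hnorm dot F ^+ 2.
  rewrite -lee_fin -pv; apply: esum_ge.
  exists [set` map s (enum 'I_n)]; first by split => //; exact: finite_seq.
  rewrite -fsbig_seq; last by rewrite map_inj_uniq ?enum_uniq.
  rewrite big_map big_enum /= -sumEFin; apply: lee_sum => i _.
  by rewrite nsq_normc.
have FE : hnorm dot F ^+ 2 = \sum_(i < n) Re ((a i)^*%C * dot F (v (s i))).
  rewrite hnorm_sqr {2}/F linear_sumr sum_Re; apply: eq_bigr => i _.
  by rewrite linearZr_LR.
have : 2 * hnorm dot F ^+ 2 <= \sum_(i < n) (nsq (a i) + nsq (dot F (v (s i)))).
  rewrite FE mulr_sumr; apply: ler_sum => i _.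
  case: (a i) => x y; case: (dot _ _) => z w; rewrite /nsq /=.
  have := sqr_ge0 (x - z); have := sqr_ge0 (y - w).
  move=> h1 h2; lra.
rewrite big_split /= => h; lra.
Qed.

End Bessel.

Section LebesgueNull.
Context {R : realType}.

(** Lebesgue measure is by construction the infimum of the total lengths of
    countable covers by half-open intervals. *)
Lemma lebesgue_null_cover (E : set (measurableTypeR R)) (eta : R) :
  lebesgue_measure E = 0%E -> 0 < eta -> exists a b : nat -> R,
  E `<=` \bigcup_k [set x | a k < x <= b k] /\
  forall n, \sum_(k < n) Num.max 0 (b k - a k) <= eta.
Proof.
move=> E0 eta0.
have /ereal_inf_lt[z [/= M [Mo EM] zE] zeta] : (lebesgue_measure E < eta%:E)%E.
  by rewrite E0 lte_fin.
have /choice[ab abP] : forall k, exists ab : R * R, M k = [set` `]ab.1, ab.2]].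
  by move=> k; have := Mo k => -[[a b] _ <-]; exists (a, b).
exists (fst \o ab), (snd \o ab); split.
  apply: subset_trans EM _; apply: subset_bigcup => k _ x; rewrite abP /=.
  by rewrite in_itv.
move=> n; rewrite -lee_fin; apply: le_trans (ltW zeta); rewrite -zE.
rewrite -sumEFin -(big_mkord xpredT (fun k => (Num.max 0 ((ab k).2 - (ab k).1))%:E)).
apply: le_trans (nneseries_lim_ge n _); last by move=> k _ _; exact: wlength_ge0.
apply: lee_sum => k _; rewrite abP wlength_itv /= lte_fin.
case: ltP => h; first by rewrite max_r ?subr_ge0 ?(ltW h).
by rewrite max_l// subr_le0.
Qed.

End LebesgueNull.

(** * Small polynomials close to 1 for a singular measure *)

Section Singular.
Context {R : realType} (mu : probability (measurableTypeR R) R).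
Hypothesis mu_carrier : mu [set` `[0%R, 1%R[] = 1%E.
Hypothesis mu_singular : mutually_singular mu
     (mrestr (@lebesgue_measure R) (@measurable_itv R `[0%R, 1%R[)).

Lemma null_support : exists E : set (measurableTypeR R),
  [/\ measurable E, mu E = 1%E & lebesgue_measure E = 0%E].
Proof.
have [A [mA A0 nA]] := mu_singular.
have mI : measurable [set` `[0 : R, 1[] by exact: measurable_itv.
exists (~` A `&` [set` `[0, 1[]); split.
- by apply: measurableI => //; exact: measurableC.
- have mE : measurable (~` A `&` [set` `[0 : R, 1[]).
    by apply: measurableI => //; exact: measurableC.
  apply/eqP; rewrite eq_le probability_le1//= -mu_carrier -(measureU0 mE mA A0).
  apply: le_measure; rewrite ?inE//; first exact: measurableU.
  by move=> x x01; case: (pselect (A x)) => Ax; [right|left].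
- exact: nA.
Qed.

(** A countable cover of the null set that carries mu exhausts the mass of mu,
    so a finite part of it does so up to eps. *)
Lemma small_cover (eps eta : R) : 0 < eps -> 0 < eta ->
  exists (a b : nat -> R) (n : nat),
    \sum_(k < n) Num.max 0 (b k - a k) <= eta /\
    (mu (~` \big[setU/set0]_(k < n) [set x | (a k < x <= b k)%R]) <= eps%:E)%E.
Proof.
move=> eps0 eta0; have [E [mE E1 E0]] := null_support.
have [a [b [Eab sab]]] := lebesgue_null_cover E0 eta0.
exists a, b; pose I k := [set x | a k < x <= b k] : set (measurableTypeR R).
have mI k : measurable (I k).
  rewrite (_ : I k = [set` `]a k, b k]]); first exact: measurable_itv.
  by apply/seteqP; split => x /=; rewrite in_itv.
pose U n := \big[setU/set0]_(k < n) I k.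
have mU n : measurable (U n) by exact: bigsetU_measurable.
have UI : mu (\bigcup_n U n) = 1%E.
  apply/eqP; rewrite eq_le; apply/andP; split.
    by apply: probability_le1; exact: bigcup_measurable.
  rewrite -E1; apply: le_measure; rewrite ?inE//; first exact: bigcup_measurable.
  move=> x /Eab[k _ kx]; exists k.+1 => //.
  by rewrite /U -bigcup_mkord; exists k => /=.
have : mu \o U @ \oo --> mu (\bigcup_n U n).
  apply: nondecreasing_cvg_mu => //; first exact: bigcup_measurable.
  by move=> m n mn; apply/subsetPset; exact: subset_bigsetU.
rewrite UI => /fine_cvgP[_ /cvgrPdist_lt /(_ _ eps0) [n _ hn]].
exists n; split; first exact: sab.
rewrite probability_setC// -/(U n).
have := hn n (leqnn n); rewrite /=.
rewrite -[mu (U n)]fineK ?fin_num_measure//=; move: (fine _) => r.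
by rewrite -EFinB lee_fin => /ltW /(le_trans (ler_norm _)).
exact: mU.
Qed.

(** The analytic form of singularity.  P is N times the sum of the peaks of the
    covering intervals; with expR delta = 1 + e1 <= 2, N = 4 / eps and a cover
    that misses mass eps / 8, the function |1 - Q|^2 is at most
    expR (delta - 2 N) <= eps / 4 on the cover and at most 2 elsewhere. *)
Lemma peak_approx (eps : R) : 0 < eps -> exists Q : {poly R[i]},
  \sum_(i < size Q) nsq Q`_i <= eps /\
  (\int[mu]_x (nsq (1 - Q.[ecirc x]))%:E <= eps%:E)%E.
Proof.
(* e1 <= eps/2 controls the coefficients, e1 <= 1 gives expR delta <= 2 *)
move=> eps0; pose e1 := Num.min 1 (eps / 2).
have e10 : 0 < e1 by rewrite lt_min ltr01 divr_gt0.
have e11 : e1 <= 1 by rewrite ge_min lexx.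
have e12 : e1 <= eps / 2 by rewrite ge_min lexx orbT.
pose delta := ln (1 + e1).
have delta0 : 0 < delta by rewrite ln_gt0// ltrDl.
have expdelta : expR delta = 1 + e1 by rewrite lnK// posrE addr_gt0.
pose N := 4 / eps; have N0 : 0 < N by rewrite divr_gt0.
(* 8^-1 is required by interval_peak; the other bound gives 2 c <= eps/2 *)
pose eta := Num.min 8^-1 (eps / (256 * N)).
have N256 : 0 < 256 * N by rewrite mulr_gt0 ?ltr0n.
have eta0 : 0 < eta by rewrite lt_min invr_gt0 ltr0n divr_gt0.
have e80 : 0 < eps / 8 by rewrite divr_gt0.
have [a [b [n [sab muC]]]] := small_cover e80 eta0.
pose I k := [set x | a k < x <= b k] : set (measurableTypeR R).
pose K := \big[setU/set0]_(k < n) I k.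
have mK : measurable K.
  apply: bigsetU_measurable => k _.
  rewrite (_ : I k = [set` `]a k, b k]]); first exact: measurable_itv.
  by apply/seteqP; split => x /=; rewrite in_itv.
have /choice[Pc Pc_spec] : forall k : 'I_n, exists Pc : {poly R[i]} * R,
  [/\ Pc.1.[0] = (Pc.2%:C)%C, 0 <= Pc.2 <= 64 * Num.max 0 (b k - a k),
      forall z, nsq z = 1 -> 0 <= Re Pc.1.[z] &
      forall x, a k < x <= b k -> 1 <= Re Pc.1.[ecirc x]].
  move=> k; have bak : b k - a k <= 8^-1.
    have : Num.max 0 (b k - a k) <= eta.
      apply: le_trans sab; rewrite (bigD1 k)//= lerDl; apply: sumr_ge0 => j _.
      by rewrite le_max lexx.
    by rewrite ge_max => /andP[_] /le_trans; apply; rewrite ge_min lexx.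
  by have [P [c Pc]] := interval_peak bak; exists (P, c).
pose P : {poly R[i]} := ((N%:C)%C) *: \sum_(k < n) (Pc k).1.
pose c := N * \sum_(k < n) (Pc k).2.
have PE z : P.[z] = (N%:C)%C * \sum_(k < n) (Pc k).1.[z].
  by rewrite /P hornerZ horner_sum.
have RePE z : Re P.[z] = N * \sum_(k < n) Re (Pc k).1.[z].
  by rewrite PE -sum_Re; case: (\sum_(_ < n) _) => ? ? /=; rewrite mul0r subr0.
have P0 : P.[0] = (c%:C)%C.
  rewrite PE /c [RHS]rmorphM /= (rmorph_sum (real_complex R)).
  congr (_ * _); apply: eq_bigr => k _.
  by have [] := Pc_spec k.
have c0 : 0 <= c.
  rewrite mulr_ge0 ?(ltW N0)// sumr_ge0// => k _.
  by have [_ /andP[]] := Pc_spec k.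
have c_le : 2 * c <= eps / 2.
  have : \sum_(k < n) (Pc k).2 <= 64 * eta.
    apply: (@le_trans _ _ (\sum_(k < n) 64 * Num.max 0 (b k - a k))).
      by apply: ler_sum => k _; have [_ /andP[]] := Pc_spec k.
    by rewrite -mulr_sumr ler_pM2l.
  have : eta <= eps / (256 * N) by rewrite ge_min lexx orbT.
  rewrite ler_pdivlMr// => h1.
  rewrite -(@ler_pM2l _ N)// -/c => h2; lra.
have ReP z : nsq z = 1 -> 0 <= Re P.[z].
  move=> z1; rewrite RePE mulr_ge0 ?(ltW N0)// sumr_ge0// => k _.
  by have [_ _ + _] := Pc_spec k; exact.
have RePK x : K x -> N <= Re P.[ecirc x].
  rewrite /K -bigcup_mkord => -[k /= kn Ikx].
  rewrite RePE -[leLHS]mulr1 ler_pM2l// (bigD1 (Ordinal kn))//=.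
  apply: ler_wpDr; last by have [_ _ _] := Pc_spec (Ordinal kn); apply.
  by apply: sumr_ge0 => j _; have [_ _ + _] := Pc_spec j; apply; exact: nsq_ecirc.
have [Q [sumQ hQ]] := small_poly_near_one P0 c0 delta0 ReP.
exists Q; split.
  by apply: (le_trans sumQ); rewrite expdelta; lra.
pose g (x : measurableTypeR R) : \bar R :=
  ((eps / 4)%:E + (2%:E * (\1_(~` K) x)%:E))%E.
apply: (@le_trans _ _ (\int[mu]_x g x)%E).
  apply: ge0_le_integral => //.
  - by move=> x _; rewrite lee_fin nsq_ge0.
  - have [] := bmeasB (bmeas_cst 1) (bmeas_horner Q bmeas_ecirc).
    by move=> m1 m2 _; exact: measurable_nsq.
  - apply: emeasurable_funD => //; apply: measurable_funeM.
    by apply/measurable_EFinP; apply: measurable_indic; exact: measurableC.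
  - move=> x _; rewrite /g -EFinM -EFinD lee_fin.
    apply: (le_trans (hQ _ (nsq_ecirc x))); rewrite indicE.
    case: (pselect (K x)) => Kx.
      rewrite memNset ?mulr0 ?addr0; last by [].
      apply: (@le_trans _ _ (expR (delta - 2 * N))).
        by rewrite ler_expR; have := RePK x Kx; lra.
      rewrite expRD expdelta.
      have : expR (- (2 * N)) <= eps / 8.
        rewrite expRN -[leRHS]invrK lef_pV2 ?posrE ?expR_gt0 ?invr_gt0 ?divr_gt0//.
        apply: le_trans (expR_ge1Dx _); rewrite /N invf_div.
        by rewrite mulrA -natrM addrC ler_wpDr.
      have := expR_ge0 (- (2 * N)) => h1 h2.
      apply: (@le_trans _ _ (2 * (eps / 8))); last by lra.
      by rewrite ler_pM//; lra.
    rewrite mem_set// mulr1.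
    apply: (@le_trans _ _ (expR delta)).
      by rewrite ler_expR; have := ReP _ (nsq_ecirc x); lra.
    by rewrite expdelta; lra.
rewrite ge0_integralD//; last 2 first.
- by move=> x _; rewrite lee_fin divr_ge0// ltW.
- apply: measurable_funeM; apply/measurable_EFinP; apply: measurable_indic.
  exact: measurableC.
rewrite integral_cst// [X in (_ * X)%E](@probability_setT _ _ _ mu) mule1.
rewrite ge0_integralZl//; last first.
  by apply/measurable_EFinP; apply: measurable_indic; exact: measurableC.
rewrite integral_indic//; last exact: measurableC.
rewrite setIT; apply: (@le_trans _ _ ((eps / 4)%:E + 2%:E * (eps / 8)%:E)%E).
  by rewrite leeD2l// lee_pmul2l.
by rewrite -EFinM -EFinD lee_fin; lra.
Qed.

End Singular.

(** * The operator kills trigonometric polynomials *)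

Section L2Estimates.
Context {R : realType} (mu : {finite_measure set (measurableTypeR R) -> \bar R}).
Local Notation T := (measurableTypeR R).
Local Notation cl := (cl mu).

Lemma N2_le (f g : T -> R[i]) (A : R) : f \in cLfun2 mu -> g \in cLfun2 mu ->
  0 <= A -> (forall x, nsq (f x) <= A * nsq (g x)) ->
  N2 (cl f) <= A * N2 (cl g).
Proof.
move=> Lf Lg A0 fg; rewrite -lee_fin EFinM !N2_cl//.
rewrite -ge0_integralZl//; last 2 first.
- exact: (cLfun2_measurable_nsq Lg).
- by move=> x _; rewrite lee_fin nsq_ge0.
apply: ge0_le_integral => //.
- by move=> x _; rewrite lee_fin nsq_ge0.
- exact: (cLfun2_measurable_nsq Lf).
- by apply: measurable_funeM; exact: (cLfun2_measurable_nsq Lg).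
- by move=> x _; rewrite -EFinM lee_fin.
Qed.

Lemma cl_sum (I : Type) (r : seq I) (f : I -> T -> R[i]) :
  (forall i, f i \in cLfun2 mu) ->
  cl (fun x => \sum_(i <- r) f i x) = \sum_(i <- r) cl (f i).
Proof.
move=> Lf; have L0 : (fun=> 0 : R[i]) \in cLfun2 mu by exact: rpred0.
have Lr s : (fun x => \sum_(i <- s) f i x) \in cLfun2 mu.
  elim: s => [|i s ih]; first by under eq_fun do rewrite big_nil.
  by under eq_fun do rewrite big_cons; exact: rpredD.
elim: r => [|i r ih].
  under eq_fun do rewrite big_nil; rewrite big_nil.
  by have := clZ 0 L0; under eq_fun do rewrite mul0r; rewrite scale0r.
by under eq_fun do rewrite big_cons; rewrite big_cons clD// ih.
Qed.

Lemma cl_horner (p : {poly R[i]}) m :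
  cl (fun x => ecirc x ^+ m * p.[ecirc x]) =
  \sum_(i < size p) p`_i *: expL2 mu (m + i).
Proof.
have Le n : (fun x => ecirc x ^+ n) \in cLfun2 mu.
  by apply: bmeas_cLfun2; exact: bmeasX (bmeas_ecirc).
under [RHS]eq_bigr do rewrite cl_expL2 -clZ//.
rewrite -cl_sum => [|i]; last exact: (rpredZ _ (Le _)).
congr cl; apply/funext => x; rewrite horner_coef mulr_sumr; apply: eq_bigr => i _.
by rewrite exprD mulrCA.
Qed.

End L2Estimates.

Section Kernel.
Context {R : realType} (mu : probability (measurableTypeR R) R).
Local Notation T := (measurableTypeR R).
Local Notation cl := (cl mu).
Hypothesis mu_carrier : mu [set` `[0%R, 1%R[] = 1%E.
Hypothesis mu_singular : mutually_singular mu
     (mrestr (@lebesgue_measure R) (@measurable_itv R `[0%R, 1%R[)).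
Variables (B : {linear L2 mu -> L2 mu}) (K : R).
Hypothesis K0 : 0 <= K.
Hypothesis BK : forall F, N2 (B F) <= K * N2 F.
Hypothesis Bsynth : forall n m (a : nat -> R[i]),
  N2 (B (\sum_(i < n) a i *: expL2 mu (m + i))) <= \sum_(i < n) nsq (a i).

Lemma N2_small (F : L2 mu) (A : R) : (forall eps, 0 < eps -> N2 F <= A * eps) ->
  F = 0.
Proof.
move=> h; apply: N2_eq0; apply/eqP; rewrite eq_le N2_ge0 andbT.
apply/ler_addgt0Pr => e e0; rewrite add0r.
have A1 : 0 < `|A| + 1 by rewrite ltr_wpDl.
apply: (le_trans (h (e / (`|A| + 1)) _)); first by rewrite divr_gt0.
rewrite mulrA ler_pdivrMr// mulrC ler_pM2l//.
by apply: (le_trans (ler_norm A)); rewrite lerDl.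
Qed.

(** The kernel of a bounded operator is closed. *)
Lemma ker_closed (F : L2 mu) :
  (forall eps, 0 < eps -> exists2 G, B G = 0 & N2 (F - G) <= eps) -> B F = 0.
Proof.
move=> h; apply: (@N2_small _ K) => eps /h[G BG FG].
have -> : B F = B (F - G) by rewrite linearB BG subr0.
by apply: (le_trans (BK _)); rewrite ler_wpM2l.
Qed.

(** e_m - e_m Q is small in L^2(mu) and boundedness applies; e_m Q has small
    coefficients and the Bessel bound [Bsynth] applies. *)
Lemma kernel_exp m : B (expL2 mu m) = 0.
Proof.
apply: (@N2_small _ (2 * K + 2)) => eps eps0.
have [Q [sQ iQ]] := peak_approx mu_carrier mu_singular eps0.
have bQ := bmeas_horner Q bmeas_ecirc; have be := bmeasX m (@bmeas_ecirc R).
pose G := cl (fun x => ecirc x ^+ m * Q.[ecirc x]).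
have L1Q : (fun x => 1 - Q.[ecirc x]) \in cLfun2 mu.
  exact/bmeas_cLfun2/bmeasB/bQ/bmeas_cst.
have NQ : N2 (cl (fun x => 1 - Q.[ecirc x])) <= eps by rewrite -lee_fin N2_cl.
rewrite -(subrK G (expL2 mu m)) linearD.
apply: (le_trans (N2D_le _ _)); rewrite [leRHS]mulrDl lerD//.
  rewrite -mulrA ler_pM2l//; apply: (le_trans (BK _)); rewrite ler_wpM2l//.
  rewrite cl_expL2 -clB; try by apply: bmeas_cLfun2 => //; exact: bmeasM.
  apply: le_trans NQ; rewrite -[leRHS]mul1r; apply: N2_le => //.
    by apply/bmeas_cLfun2/bmeasB => //; exact: bmeasM.
  by move=> x; rewrite -{1}[ecirc x ^+ m]mulr1 -mulrBr nsqM nsqX nsq_ecirc expr1n.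
rewrite ler_pM2l// /G cl_horner.
exact: le_trans (Bsynth _ _ _) sQ.
Qed.

(** Trigonometric polynomials, as a negative power of e(x) times an ordinary
    polynomial in e(x). *)
Definition is_trig (f : T -> R[i]) : Prop := exists (k : nat) (p : {poly R[i]}),
  f = fun x => (ecirc x)^*%C ^+ k * p.[ecirc x].

Lemma bmeas_trig f : is_trig f -> bmeas f.
Proof.
move=> [k [p ->]]; apply: bmeasM; last exact: bmeas_horner bmeas_ecirc.
by apply: bmeasX; apply: bmeas_conj; exact: bmeas_ecirc.
Qed.

Lemma poly_split (q : {poly R[i]}) : exists g, q = g * 'X + (q`_0)%:P.
Proof.
elim/poly_ind: q => [|g c _]; first by exists 0; rewrite coef0 mul0r add0r.
by exists g; rewrite coefD coefMX coefC /= add0r.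
Qed.

Lemma conj_ecircK (x : T) : (ecirc x)^*%C * ecirc x = 1.
Proof. by rewrite mulrC mulz_conj nsq_ecirc. Qed.

(** Induction on the power k of the conjugate of e.  Writing Q = g e + Q_0,
    the function conj e is close to conj e (Q - Q_0) = g, which trades one
    factor conj e for an ordinary polynomial. *)
Lemma kernel_trig f : is_trig f -> B (cl f) = 0.
Proof.
move=> [k [p ->]]; elim: k p => [|k ih] p.
  rewrite (_ : (fun _ => _) = (fun x => ecirc x ^+ 0 * p.[ecirc x])); last first.
    by apply/funext => x; rewrite !expr0.
  by rewrite cl_horner linear_sum big1// => i _; rewrite linearZ_LR kernel_exp scaler0.
have [p' pE] := poly_split p; set c := p`_0 in pE.
apply: ker_closed => eps eps0.
have nc : 0 <= nsq c := nsq_ge0 c.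
pose e1 := eps / (4 * (nsq c + 1)).
have e10 : 0 < e1 by rewrite divr_gt0// mulr_gt0// ltr_wpDl.
have [Q [sQ iQ]] := peak_approx mu_carrier mu_singular e10.
have bQ := bmeas_horner Q bmeas_ecirc.
have [g QE] := poly_split Q.
exists (cl (fun x => (ecirc x)^*%C ^+ k * (p' + c *: g).[ecirc x])); first exact: ih.
have L1Q : (fun x => 1 - Q.[ecirc x]) \in cLfun2 mu.
  exact/bmeas_cLfun2/bmeasB/bQ/bmeas_cst.
have LQ0 : (fun=> Q`_0) \in cLfun2 mu by exact/bmeas_cLfun2/bmeas_cst.
have NQ : N2 (cl (fun x => 1 - Q.[ecirc x])) <= e1 by rewrite -lee_fin N2_cl.
have NQ0 : N2 (cl (fun=> Q`_0)) <= e1.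
  rewrite -lee_fin N2_cl// integral_cst// [X in (_ * X)%E](@probability_setT _ _ _ mu).
  rewrite mule1 lee_fin; apply: le_trans sQ.
  have [s0|s1] := posnP (size Q).
    rewrite nth_default ?s0// /nsq /= expr0n addr0.
    by apply: sumr_ge0 => i _; exact: nsq_ge0.
  rewrite (bigD1 (Ordinal s1))//= lerDl sumr_ge0// => i _; exact: nsq_ge0.
have bc := bmeasX k (bmeas_conj (@bmeas_ecirc R)).
have bc1 := bmeasX k.+1 (bmeas_conj (@bmeas_ecirc R)).
have bp (q : {poly R[i]}) := bmeas_horner q bmeas_ecirc.
rewrite -clB; try by apply: bmeas_cLfun2 => //; exact: bmeasM.
apply: (@le_trans _ _ (nsq c * N2 (cl (fun x => (1 - Q.[ecirc x]) + Q`_0)))).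
  apply: N2_le => //.
  - by apply/bmeas_cLfun2/bmeasB; exact: bmeasM.
  - exact: rpredD.
  move=> x; rewrite -nsqM.
  rewrite (_ : _ - _ = (ecirc x)^*%C ^+ k.+1 * (c * (1 - Q.[ecirc x] + Q`_0))).
    by rewrite nsqM nsqX nsq_conj nsq_ecirc expr1n mul1r.
  have := conj_ecircK x.
  set u := (ecirc x)^*%C; set e := ecirc x => ue.
  rewrite pE QE !hornerE coefD coefMX coefC /= add0r exprSr.
  transitivity (u ^+ k * (u * e) * p'.[e] + u ^+ k * u * c
    - u ^+ k * (p'.[e] + c * g.[e])); first by ring.
  transitivity (u ^+ k * u * c - u ^+ k * (u * e) * c * g.[e]).
    by rewrite ue; ring.
  by ring.
rewrite clD//; apply: (@le_trans _ _ (nsq c * (4 * e1))).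
  rewrite ler_wpM2l//; apply: (le_trans (N2D_le _ _)); lra.
have c1 : 0 < nsq c + 1 by rewrite ltr_wpDl.
have -> : nsq c * (4 * e1) = eps * (nsq c / (nsq c + 1)).
  rewrite /e1; move: (nsq c) c1 => s s1; by field; rewrite gt_eqF.
by rewrite ler_piMr ?(ltW eps0)// ler_pdivrMr// mul1r lerDl.
Qed.

End Kernel.

(** * Trigonometric polynomials and thresholds *)

Section TrigClosure.
Context {R : realType}.
Local Notation T := (measurableTypeR R).
Implicit Types f g : T -> R[i].

Lemma is_trig_cst (c : R[i]) : is_trig (fun=> c).
Proof. by exists 0, c%:P; apply/funext => x; rewrite mul1r hornerC. Qed.

Lemma is_trigM f g : is_trig f -> is_trig g -> is_trig (fun x => f x * g x).
Proof.
move=> [k [p ->]] [l [q ->]]; exists (k + l)%N, (p * q); apply/funext => x.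
by rewrite hornerM exprD; ring.
Qed.

(** Common denominator: conj e ^+ k = conj e ^+ (k + l) * e ^+ l. *)
Lemma is_trigD f g : is_trig f -> is_trig g -> is_trig (fun x => f x + g x).
Proof.
move=> [k [p ->]] [l [q ->]]; exists (k + l)%N, ('X^l * p + 'X^k * q).
apply/funext => x; rewrite hornerD !hornerM !hornerXn exprD.
have ce n : (ecirc x)^*%C ^+ n * ecirc x ^+ n = 1.
  by rewrite -exprMn conj_ecircK expr1n.
move: (ce k) (ce l); set u := (ecirc x)^*%C; set e := ecirc x => ck cl.
transitivity (u ^+ k * (u ^+ l * e ^+ l) * p.[e] + u ^+ l * (u ^+ k * e ^+ k) * q.[e]).
  by rewrite ck cl !mulr1.
by ring.
Qed.

Lemma is_trigX f n : is_trig f -> is_trig (fun x => f x ^+ n).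
Proof.
move=> tf; elim: n => [|n ih]; first exact: is_trig_cst.
rewrite (_ : (fun _ => _) = (fun x => f x * f x ^+ n)); first exact: is_trigM.
by apply/funext => x; rewrite exprS.
Qed.

Lemma is_trig_ecirc : is_trig (@ecirc R).
Proof. by exists 0, 'X; apply/funext => x; rewrite mul1r hornerX. Qed.

Lemma is_trig_conj_ecirc : is_trig (fun x : T => (ecirc x)^*%C).
Proof. by exists 1%N, 1; apply/funext => x; rewrite hornerC mulr1. Qed.

Lemma is_trig_cos : is_trig (fun x : T => (cos (2 * pi * x))%:C%C).
Proof.
rewrite (_ : (fun _ => _) =
    (fun x => (2^-1%:C)%C * ecirc x + (2^-1%:C)%C * (ecirc x)^*%C)).
  apply: is_trigD; apply: is_trigM; do ?exact: is_trig_cst.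
  - exact: is_trig_ecirc.
  - exact: is_trig_conj_ecirc.
apply/funext => x; apply/eqP; rewrite eq_complex /=.
by apply/andP; split; apply/eqP; field.
Qed.

Lemma is_trig_sin : is_trig (fun x : T => (sin (2 * pi * x))%:C%C).
Proof.
rewrite (_ : (fun _ => _) =
    (fun x => (Complex 0 (- 2^-1)) * ecirc x + (Complex 0 2^-1) * (ecirc x)^*%C)).
  apply: is_trigD; apply: is_trigM; do ?exact: is_trig_cst.
  - exact: is_trig_ecirc.
  - exact: is_trig_conj_ecirc.
apply/funext => x; apply/eqP; rewrite eq_complex /=.
by apply/andP; split; apply/eqP; field.
Qed.

Lemma is_trig_real_affine (q : T -> R) (a b : R) :
  is_trig (fun x => (q x)%:C%C) -> is_trig (fun x => (a + b * q x)%:C%C).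
Proof.
move=> tq; rewrite (_ : (fun _ => _) = (fun x => a%:C%C + b%:C%C * (q x)%:C%C)).
  by apply: is_trigD; [exact: is_trig_cst|apply: is_trigM => //; exact: is_trig_cst].
by apply/funext => x; rewrite rmorphD rmorphM.
Qed.

Lemma is_trig_realX (q : T -> R) n :
  is_trig (fun x => (q x)%:C%C) -> is_trig (fun x => (q x ^+ n)%:C%C).
Proof.
move=> /(is_trigX n); rewrite (_ : (fun _ => _) = (fun x => (q x ^+ n)%:C%C))//.
by apply/funext => x; rewrite rmorphXn.
Qed.

End TrigClosure.

Section Threshold.
Context {R : realType}.
Implicit Types y : R.

(** Polynomials on [0, 1] that converge to 1 for y <= 1/2 and to 0 for
    y > 1/2, endpoint included: with N = n + 1 and t = y ^ (2 N) / N, the number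
    4 ^ N * t is (2 y) ^ (2 N) / N, which tends to 0 in the first case and
    to infinity in the second one.  The shape 1 + b * _ suits
    [is_trig_real_affine]. *)
Definition plateau n y : R := (1 + (- n.+1%:R^-1) * y ^+ (2 * n.+1)) ^+ (4 ^ n.+1).

Let plateauE n y : plateau n y = (1 - y ^+ (2 * n.+1) / n.+1%:R) ^+ (4 ^ n.+1).
Proof. by rewrite /plateau mulNr mulrC. Qed.

Let base01 n y : 0 <= y <= 1 -> 0 <= y ^+ (2 * n.+1) / n.+1%:R <= 1.
Proof.
move=> /andP[y0 y1]; rewrite divr_ge0 ?exprn_ge0//= ler_pdivrMr ?ltr0n// mul1r.
by apply: (@le_trans _ _ 1); rewrite ?exprn_ile1// ler1n.
Qed.

Lemma plateau01 n y : 0 <= y <= 1 -> 0 <= plateau n y <= 1.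
Proof.
move=> /(base01 n)/andP[b0 b1]; rewrite plateauE exprn_ge0 ?subr_ge0//=.
by rewrite exprn_ile1 ?subr_ge0// lerBlDr lerDl.
Qed.

Lemma plateau_low n y : 0 <= y <= 2^-1 -> 1 - n.+1%:R^-1 <= plateau n y.
Proof.
move=> /andP[y0 y2]; have y1 : 0 <= y <= 1 by apply/andP; split => //; lra.
rewrite plateauE; have /andP[_ b1] := base01 n y1.
apply: le_trans (bernoulli_ineq _ _); last by rewrite lerN2.
rewrite mulrN lerD2l lerN2 mulrA ler_piMl ?invr_ge0//.
rewrite natrX exprM -exprMn exprn_ile1 ?mulr_ge0 ?exprn_ge0//.
have : y ^+ 2 <= 2^-1 ^+ 2 by rewrite lerXn2r ?nnegrE ?invr_ge0.
rewrite exprVn => h; rewrite -(@ler_pM2l _ 4^-1)// mulrA mulVf// mul1r mulr1.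
by apply: (le_trans h); rewrite lef_pV2 ?posrE// -natrX ler_nat.
Qed.

(** From (1 - t)^m <= expR (- m t) <= 1 / (m t), and
    (2 y) ^ (2 N) >= ((1 + h) ^ N) ^ 2 >= (N h) ^ 2. *)
Lemma plateau_high n y (h : R) : 0 < h -> 2^-1 + h <= y <= 1 ->
  plateau n y <= (h ^+ 2)^-1 / n.+1%:R.
Proof.
move=> h0 /andP[yh y1]; have y01 : 0 <= y <= 1 by apply/andP; split => //; lra.
have /andP[b0 b1] := base01 n y01; set N := n.+1 in b0 b1 *.
have N0 : 0 < N%:R :> R by rewrite ltr0n.
rewrite plateauE -/N; set b := y ^+ _ / _ in b0 b1 *.
apply: (@le_trans _ _ (expR (- b) ^+ (4 ^ N))).
  by rewrite lerXn2r ?nnegrE ?subr_ge0 ?expR_ge0//; exact: expR_ge1Dx.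
rewrite -expRM_natl mulrN expRN -invfM lef_pV2 ?posrE ?expR_gt0//; last first.
  by rewrite mulr_gt0// exprn_gt0.
apply: le_trans (expR_ge1Dx _); apply: ler_wpDl => //.
rewrite /b mulrA natrX (exprM y 2) -exprMn.
rewrite ler_pdivlMr// -mulrA -expr2 -exprMn.
have : 1 + N%:R * h <= (1 + h) ^+ N.
  by apply: bernoulli_ineq; lra.
move=> h1; have h2 : h * N%:R <= (1 + h) ^+ N.
  by apply: le_trans h1; rewrite mulrC lerDr.
have p1 : 0 <= 1 + h by lra.
have hN0 : 0 <= h * N%:R by rewrite mulr_ge0 ?(ltW h0).
apply: (@le_trans _ _ (((1 + h) ^+ N) ^+ 2)).
  by rewrite lerXn2r ?nnegrE ?exprn_ge0.
rewrite -exprM mulnC exprM (_ : 4 * y ^+ 2 = (2 * y) ^+ 2); last by ring.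
have y20 : 0 <= 2 * y by lra.
rewrite lerXn2r ?nnegrE ?exprn_ge0// lerXn2r ?nnegrE//; lra.
Qed.

End Threshold.

(** * Indicators of Borel sets are limits of trigonometric polynomials *)

Section Approximable.
Context {R : realType} (mu : probability (measurableTypeR R) R).
Local Notation T := (measurableTypeR R).
Local Notation cl := (cl mu).

(** Dominated convergence in L^2(mu). *)
Lemma N2_cvg0 (u : nat -> T -> R[i]) (g : T -> R) :
  (forall n, u n \in cLfun2 mu) -> mu.-integrable setT (EFin \o g) ->
  (forall n x, nsq (u n x) <= g x) ->
  (forall x, nsq (u n x) @[n --> \oo] --> 0) ->
  forall eps, 0 < eps -> exists n, N2 (cl (u n)) <= eps.
Proof.
move=> Lu ig ug u0 eps eps0.
have [] := @dominated_convergence _ _ _ mu setT measurableT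
  (fun n x => (nsq (u n x))%:E) (cst 0%E) (EFin \o g).
- by move=> n; exact: (cLfun2_measurable_nsq (Lu n)).
- exact: measurable_cst.
- by apply: aeW => x _; apply: cvg_EFin; [exact: nearW|apply: u0].
- exact: ig.
- by apply: aeW => x n _ /=; rewrite lee_fin ger0_norm ?nsq_ge0.
move=> _ _; rewrite integral_cst// mul0e => /fine_cvgP[_].
move=> /cvgrPdist_lt /(_ _ eps0) [n _ hn]; exists n.
have := hn n (leqnn n); rewrite /= -N2_cl//= sub0r normrN => /ltW.
exact/le_trans/ler_norm.
Qed.

Definition ind (A : set T) (x : T) : R[i] := ((\1_A x : R)%:C)%C.

Lemma indic01 (A : set T) x : 0 <= (\1_A x : R) <= 1.
Proof. by rewrite indicE; case: (_ \in _); rewrite /= ?lexx ler01. Qed.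

Lemma bmeas_ind A : measurable A -> bmeas (ind A).
Proof.
by move=> mA; apply: bmeas_real (indic01 A); exact: measurable_indic.
Qed.

(** The range condition 0 <= r <= 1 makes products of approximations
    approximations of products. *)
Definition approximable (A : set T) : Prop :=
  measurable A /\ forall eps, 0 < eps -> exists r : T -> R,
    [/\ is_trig (fun x => (r x)%:C%C), forall x, 0 <= r x <= 1 &
        N2 (cl (fun x => (r x)%:C%C - ind A x)) <= eps].

Lemma trig_measurable (r : T -> R) :
  is_trig (fun x => (r x)%:C%C) -> measurable_fun setT r.
Proof. by move=> /bmeas_trig[]. Qed.

(** Composing q with [plateau], after the affine change that sends the level s
    to 1/2 and keeps the values in [0, 1]. *)
Lemma approximable_threshold (q : T -> R) (s : R) :
  is_trig (fun x => (q x)%:C%C) -> (forall x, -1 <= q x <= 1) -> -1 <= s <= 1 ->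
  approximable [set x | s <= q x].
Proof.
move=> tq q1 s1; set A := [set x | _].
have mA : measurable A.
  rewrite (_ : A = setT `&` q @^-1` [set` `[s, +oo[]).
    by apply: (trig_measurable tq) => //; exact: measurable_itv.
  by apply/seteqP; split => x /=; rewrite in_itv/= andbT // => -[].
split => // eps eps0.
pose y x := (2^-1 + s / 4) + (- 4^-1) * q x.
have yE x : y x = 2^-1 + (s - q x) / 4 by rewrite /y; ring.
have y01 x : 0 <= y x <= 1.
  by have /andP[? ?] := q1 x; have /andP[? ?] := s1; apply/andP; split; rewrite yE; lra.
pose r n x := plateau n (y x).
have tr n : is_trig (fun x => (r n x)%:C%C).
  by apply/is_trig_realX/is_trig_real_affine/is_trig_realX/is_trig_real_affine.
have r01 n x : 0 <= r n x <= 1 by exact: plateau01.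
pose u n x := (r n x)%:C%C - ind A x.
have uE n x : nsq (u n x) = (r n x - \1_A x) ^+ 2.
  by rewrite -nsq_real rmorphB.
have [||||n hn] := @N2_cvg0 u (cst 1) _ _ _ _ eps eps0.
- move=> n; apply/bmeas_cLfun2/bmeasB; last exact: bmeas_ind.
  exact: bmeas_trig (tr n).
- by apply: finite_measure_integrable_cst.
- move=> n x; rewrite uE /=; have /andP[? ?] := r01 n x.
  have /andP[? ?] := indic01 A x.
  by rewrite -real_normK ?num_real// expr_le1// ler_norml; apply/andP; split; lra.
- move=> x.
  (* pointwise, the error is O(1/n); since it lies in [0, 1], so does its square *)
  have [C hC] : exists C, forall n, nsq (u n x) <= C * n.+1%:R^-1.
    have sq (t : R) : 0 <= t <= 1 -> t ^+ 2 <= t.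
      by move=> /andP[t0 t1]; rewrite expr2 ler_piMr.
    case: (pselect (A x)) => Ax.
      exists 1 => n; rewrite uE indicE mem_set//= mul1r -sqrrN opprB.
      have /andP[r0 r1] := r01 n x.
      apply: le_trans (sq _ _) _; first by apply/andP; split; lra.
      rewrite lerBlDl -lerBlDr; apply: plateau_low.
      have /andP[-> _] := y01 x; rewrite yE; move: Ax; rewrite /A /= => ?; lra.
    exists ((y x - 2^-1) ^+ 2)^-1 => n; rewrite uE indicE memNset//= subr0.
    apply: le_trans (sq _ (r01 n x)) _; apply: plateau_high.
      by move/negP: Ax; rewrite -ltNge yE => ?; lra.
    by rewrite addrC subrK lexx; have /andP[_ ->] := y01 x.
  apply: (@squeeze_cvgr _ _ _ _ (fun=> 0) (fun n => C * n.+1%:R^-1)).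
  + by apply: nearW => n; rewrite nsq_ge0 hC.
  + exact: cvg_cst.
  + by rewrite -[X in _ --> X](mulr0 C); apply: cvgMl_tmp; exact: cvg_harmonic.
by exists (r n).
Qed.

Lemma approximableC A : approximable A -> approximable (~` A).
Proof.
move=> [mA hA]; split; first exact: measurableC.
move=> eps /hA[r [tr r01 Nr]]; exists (fun x => 1 + (-1) * r x); split.
- exact: is_trig_real_affine.
- by move=> x; have /andP[? ?] := r01 x; apply/andP; split; lra.
have iC x : \1_(~` A) x = 1 - \1_A x :> R.
  by rewrite !indicE in_setC; case: (x \in A); rewrite /= ?subrr ?subr0.
have br := bmeas_trig tr; have bA := bmeas_ind mA.
apply: le_trans Nr; rewrite -[leRHS]mul1r; apply: N2_le => //.
- apply/bmeas_cLfun2/bmeasB; last exact/bmeas_ind/measurableC.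
  by apply: bmeas_trig; exact: is_trig_real_affine.
- exact/bmeas_cLfun2/bmeasB.
move=> x; rewrite mul1r /ind iC -!rmorphB /= !nsq_real.
have -> : 1 + -1 * r x - (1 - \1_A x) = - (r x - \1_A x) by ring.
by rewrite sqrrN.
Qed.

(** r s - 1_A 1_A' = s (r - 1_A) + 1_A (s - 1_A'), with both outer factors in
    [0, 1]. *)
Lemma approximableI A A' :
  approximable A -> approximable A' -> approximable (A `&` A').
Proof.
move=> [mA hA] [mA' hA']; split; first exact: measurableI.
move=> eps eps0; have e4 : 0 < eps / 4 by rewrite divr_gt0.
have [r [tr r01 Nr]] := hA _ e4; have [s [ts s01 Ns]] := hA' _ e4.
have br := bmeas_trig tr; have bs := bmeas_trig ts.
have bA := bmeas_ind mA; have bA' := bmeas_ind mA'.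
have rsE : (fun x => (r x * s x)%:C%C) = (fun x => (r x)%:C%C * (s x)%:C%C).
  by apply/funext => x; rewrite rmorphM.
have trs : is_trig (fun x => (r x * s x)%:C%C) by rewrite rsE; exact: is_trigM.
exists (fun x => r x * s x); split => //.
  move=> x; have /andP[r0 r1] := r01 x; have /andP[s0 s1] := s01 x.
  by rewrite mulr_ge0//= mulr_ile1.
have iE x : ind (A `&` A') x = ind A x * ind A' x.
  by rewrite /ind -rmorphM indicI.
pose v x := (s x)%:C%C * ((r x)%:C%C - ind A x).
pose w x := ind A x * ((s x)%:C%C - ind A' x).
have bv : bmeas v by apply: bmeasM => //; exact: bmeasB.
have bw : bmeas w by apply: bmeasM => //; exact: bmeasB.
have -> : (fun x => (r x * s x)%:C%C - ind (A `&` A') x) = (fun x => v x + w x).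
  by apply/funext => x; rewrite iE rmorphM /v /w; ring.
have le01 (t : R) (z : R[i]) : 0 <= t <= 1 -> nsq (t%:C%C * z) <= 1 * nsq z.
  move=> /andP[t0 t1]; rewrite nsqM nsq_real ler_wpM2r ?nsq_ge0//.
  by rewrite exprn_ile1.
rewrite clD; [|exact: bmeas_cLfun2..]; apply: (le_trans (N2D_le _ _)).
have : N2 (cl v) <= 1 * N2 (cl (fun x => (r x)%:C%C - ind A x)).
  apply: N2_le => //; try exact/bmeas_cLfun2/bmeasB; first exact: bmeas_cLfun2.
  by move=> x; exact: le01.
have : N2 (cl w) <= 1 * N2 (cl (fun x => (s x)%:C%C - ind A' x)).
  apply: N2_le => //; try exact/bmeas_cLfun2/bmeasB; first exact: bmeas_cLfun2.
  by move=> x; apply: le01; exact: indic01.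
move: (N2 _) (N2 _) (N2 _) (N2 _) Nr Ns => a b c d ? ? ? ?; lra.
Qed.

Lemma approximable_closed A : measurable A ->
  (forall eps, 0 < eps -> exists2 A', approximable A' &
     N2 (cl (fun x => ind A' x - ind A x)) <= eps) ->
  approximable A.
Proof.
move=> mA h; split => // eps eps0; have e4 : 0 < eps / 4 by rewrite divr_gt0.
have [A' [mA' hA'] NA'] := h _ e4; have [r [tr r01 Nr]] := hA' _ e4.
exists r; split => //.
have br := bmeas_trig tr; have bA := bmeas_ind mA; have bA' := bmeas_ind mA'.
have -> : (fun x => (r x)%:C%C - ind A x) =
    (fun x => ((r x)%:C%C - ind A' x) + (ind A' x - ind A x)).
  by apply/funext => x; rewrite addrA subrK.
rewrite clD; try exact/bmeas_cLfun2/bmeasB.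
apply: (le_trans (N2D_le _ _)); move: (N2 _) (N2 _) Nr NA' => a b ? ?; lra.
Qed.

Lemma approximableU A A' :
  approximable A -> approximable A' -> approximable (A `|` A').
Proof.
move=> aA aA'; rewrite -[_ `|` _]setCK setCU.
by apply/approximableC/approximableI; exact: approximableC.
Qed.

Lemma approximable_bigsetU (A : nat -> set T) n : (forall k, approximable (A k)) ->
  approximable set0 -> approximable (\big[setU/set0]_(k < n) A k).
Proof.
move=> aA a0; elim: n => [|n ih]; first by rewrite big_ord0.
by rewrite big_ord_recr /=; exact: (approximableU ih (aA n)).
Qed.

Lemma N2_ind_diff (A A' : set T) : measurable A -> measurable A' -> A' `<=` A ->
  ((N2 (cl (fun x => ind A' x - ind A x)))%:E = mu (A `\` A'))%E.
Proof.
move=> mA mA' A'A; rewrite N2_cl; last first.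
  by apply/bmeas_cLfun2/bmeasB; exact: bmeas_ind.
rewrite -[in RHS](setIT (A `\` A')) -integral_indic//; last exact: measurableD.
apply: eq_integral => x _; congr EFin.
rewrite -rmorphB /= nsq_real !indicE in_setD.
have : (x \in A') ==> (x \in A).
  by apply/implyP; rewrite !inE; exact: A'A.
case: (x \in A) (x \in A') => [] [] //= _; rewrite ?subrr ?expr0n//.
by rewrite sub0r sqrrN expr1n.
Qed.

(** The finite unions exhaust the mass of the countable one, and
    [approximable_closed] applies. *)
Lemma approximable_bigcup (A : nat -> set T) : (forall k, approximable (A k)) ->
  approximable set0 -> approximable (\bigcup_k A k).
Proof.
move=> aA a0; pose U n := \big[setU/set0]_(k < n) A k.
have aU n : approximable (U n) by exact: approximable_bigsetU.
have mU n : measurable (U n) by case: (aU n).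
have mA : measurable (\bigcup_k A k).
  by apply: bigcup_measurable => k _; case: (aA k).
have UA : \bigcup_n U n = \bigcup_k A k.
  apply/seteqP; split => x.
    by move=> [n _]; rewrite /U -bigcup_mkord => -[k _ Ak]; exists k.
  by move=> [k _ Ak]; exists k.+1 => //; rewrite /U -bigcup_mkord; exists k => /=.
apply: approximable_closed => // eps eps0.
have : mu \o U @ \oo --> mu (\bigcup_n U n).
  apply: nondecreasing_cvg_mu => //; first by rewrite UA.
  by move=> m n mn; apply/subsetPset; exact: subset_bigsetU.
rewrite UA -[mu (\bigcup_k A k)]fineK ?fin_num_measure//.
move=> /fine_cvgP[_ /cvgrPdist_lt /(_ _ eps0) [n _ hn]].
exists (U n); first exact: aU.
have UnA : U n `<=` \bigcup_k A k by rewrite -UA; exact: bigcup_sup.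
rewrite -lee_fin N2_ind_diff// measureD//; last first.
  by rewrite ltey_eq fin_num_measure.
rewrite (_ : _ `&` U n = U n); last by rewrite setIC; apply/setIidPl.
have := hn n (leqnn n); rewrite /=.
rewrite -[X in (X - _)%E]fineK ?fin_num_measure//.
rewrite -[X in (_ - X)%E]fineK ?fin_num_measure//.
by rewrite -EFinB lee_fin => /ltW /(le_trans (ler_norm _)).
Qed.

Hypothesis mu_carrier : mu [set` `[0%R, 1%R[] = 1%E.

Lemma cl_eq_carrier (f g : T -> R[i]) : f \in cLfun2 mu -> g \in cLfun2 mu ->
  (forall x, 0 <= x < 1 -> f x = g x) -> cl f = cl g.
Proof.
move=> Lf Lg fg; rewrite !clE; apply/L2classP.
have mI : measurable ([set` `[0 : R, 1[] : set T) by exact: measurable_itv.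
exists (~` [set` `[0, 1[]); split.
- exact: measurableC.
- have : mu (~` [set` `[0%R, 1%R[]) = 0%E.
    by rewrite probability_setC// mu_carrier subee.
  exact.
- by move=> x /= nfg; rewrite in_itv /= => x01; apply: nfg; exact: fg.
Qed.

(** The measure only sees [0, 1), where x and exp (2 pi i x) determine each
    other. *)
Lemma approximable_ext (A A' : set T) : measurable A' ->
  (forall x : R, 0 <= x < 1 -> A x <-> A' x) -> approximable A -> approximable A'.
Proof.
move=> mA' AA' [mA hA]; split; first exact: mA'.
move=> eps /hA[r [tr r01 Nr]]; exists r; split; [exact: tr|exact: r01|].
apply: le_trans Nr; rewrite le_eqVlt; apply/orP; left; apply/eqP; congr N2.
have br := bmeas_trig tr; have bA := bmeas_ind mA; have bA' := bmeas_ind mA'.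
apply: cl_eq_carrier; try exact/bmeas_cLfun2/bmeasB.
move=> x /AA' h; rewrite /ind !indicE; congr (_ - ((nat_of_bool _)%:R%:C)%C).
by apply/idP/idP; rewrite !inE h.
Qed.

Lemma approximable_setT : approximable setT.
Proof.
have h : approximable [set x : T | 0 <= (cst 0 x : R)].
  apply: (@approximable_threshold (cst 0) 0).
  - exact: (is_trig_cst 0).
  - by move=> x /=; apply/andP; split; lra.
  - by apply/andP; split; lra.
rewrite (_ : setT = [set x : T | 0 <= (cst 0 x : R)]); first exact: h.
by apply/seteqP; split => x //= _; exact: lexx.
Qed.

Lemma approximable_set0 : approximable set0.
Proof. by rewrite -setCT; apply: approximableC; exact: approximable_setT. Qed.

(** Inside [0, 1), the point x is in the first half circle when
    sin (2 pi x) >= 0, and each half circle is ordered by cos (2 pi x). *)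
Lemma approximable_ray (a : R) : approximable [set x : T | x <= a].
Proof.
have mray : measurable ([set x | x <= a] : set T).
  rewrite (_ : [set x | _] = [set` `]-oo, a]]); first exact: measurable_itv.
  by apply/seteqP; split => x /=; rewrite in_itv.
have p0 := pi_gt0 R.
have [a0|a0] := ltP a 0.
  apply: approximable_ext approximable_set0 => // x /andP[x0 _] /=.
  by split => // xa; have := le_lt_trans x0 (le_lt_trans xa a0); rewrite ltxx.
have [a1|a1] := leP 1 a.
  apply: approximable_ext approximable_setT => // x /andP[_ x1] /=.
  by split => // _; exact: le_trans (ltW x1) a1.
have cosab (t : R) : -1 <= cos t <= 1 by rewrite cos_geN1 cos_le1.
have sinab (t : R) : -1 <= sin t <= 1 by rewrite sin_geN1 sin_le1.
have a_sin : approximable [set x : T | 0 <= sin (2 * pi * x)].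
  by apply: (approximable_threshold (@is_trig_sin R)) => //; apply/andP; split; lra.
have sinE (x : R) : 0 <= x < 1 -> (0 <= sin (2 * pi * x)) = (x <= 2^-1).
  move=> /andP[x0 x1]; have [xh|xh] := leP x 2^-1.
    apply: sin_ge0_pi; rewrite mulr_ge0 ?mulr_ge0 ?(ltW p0)//=.
    by rewrite mulrAC ler_piMl ?(ltW p0)//; lra.
  apply/negbTE; rewrite -ltNge.
  have -> : 2 * pi * x = (2 * pi * x - pi) + pi by rewrite subrK.
  have := @sinDpi R (2 * pi * x - pi); rewrite /= => ->.
  rewrite oppr_lt0; apply: sin_gt0_pi.
  have h1 : pi * 1 < pi * (2 * x) by rewrite ltr_pM2l//; lra.
  have h2 : pi * (2 * x) < pi * 2 by rewrite ltr_pM2l//; lra.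
  by apply/andP; split; lra.
have low (t : R) : 0 <= t <= 2^-1 -> 2 * pi * t \in `[0, pi].
  move=> /andP[t0 t1]; rewrite in_itv /=; apply/andP; split.
    by rewrite !mulr_ge0// ltW.
  by rewrite mulrAC ler_piMl ?(ltW p0)//; lra.
have cos_le (t v : R) : 0 <= t <= 2^-1 -> 0 <= v <= 2^-1 ->
    (cos (2 * pi * t) <= cos (2 * pi * v)) = (v <= t).
  move=> /low ht /low hv; rewrite !leNgt (ltr_cos ht hv) ltr_pM2l// mulr_gt0//.
have refl (t : R) : cos (2 * pi * t) = cos (2 * pi * (1 - t)).
  rewrite -[LHS]cosN; have <- := @cosD2pi R (- (2 * pi * t)).
  by congr cos; rewrite -[pi *+ 2]mulr_natl; ring.
have [ah|ah] := leP a 2^-1.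
  have a_cos := approximable_threshold (@is_trig_cos R)
    (fun x => cosab (2 * pi * x)) (cosab (2 * pi * a)).
  apply: (approximable_ext mray _ (approximableI a_cos a_sin)) => x x01 /=.
  rewrite sinE//; have /andP[x0 x1] := x01.
  split=> [[+ xh]|xa]; first by rewrite cos_le ?a0 ?ah ?x0.
  have xh := le_trans xa ah.
  by rewrite cos_le ?a0 ?ah ?x0.
have cosN_ab (x : R) : -1 <= 0 + (-1) * cos (2 * pi * x) <= 1.
  by have /andP[? ?] := cosab (2 * pi * x); apply/andP; split; lra.
have a_cos := approximable_threshold (is_trig_real_affine 0 (-1) (@is_trig_cos R))
  cosN_ab (cosN_ab a).
apply: (approximable_ext mray _ (approximableU a_sin a_cos)) => x x01 /=.
rewrite sinE// !add0r !mulN1r lerN2; have /andP[x0 x1] := x01.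
have [xh|xh] := leP x 2^-1.
  by split => // _; [exact: le_trans xh (ltW ah)|left].
rewrite (refl x) (refl a) cos_le; try by apply/andP; split; lra.
rewrite lerD2l lerN2.
by split=> [[]//|]; right.
Qed.

(** Approximable sets form a sigma-algebra that contains the generators
    ]a, b] of the Borel sets. *)
Lemma measurable_approximable (A : set T) : measurable A -> approximable A.
Proof.
have sa : sigma_algebra setT approximable.
  split; first exact: approximable_set0.
  - by move=> X aX; rewrite setTD; exact: approximableC.
  - by move=> F aF; apply: approximable_bigcup => //; exact: approximable_set0.
apply: smallest_sub => //.
move=> _ [[a b] _ <-] /=.
rewrite (_ : [set` _] = [set x : T | x <= b] `&` ~` [set x : T | x <= a]).
  apply: approximableI; last apply: approximableC; exact: approximable_ray.
apply/seteqP; split => x /=; rewrite in_itv /=.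
  by move=> /andP[ax xb]; split => //; apply/negP; rewrite -ltNge.
by move=> [xb /negP]; rewrite -ltNge => ->.
Qed.

End Approximable.

(** * Density of trigonometric polynomials, and the theorem *)

Section KernelDense.
Context {R : realType} (mu : probability (measurableTypeR R) R).
Local Notation T := (measurableTypeR R).
Local Notation cl := (cl mu).
Hypothesis mu_carrier : mu [set` `[0%R, 1%R[] = 1%E.
Variables (B : {linear L2 mu -> L2 mu}) (K : R).
Hypothesis K0 : 0 <= K.
Hypothesis BK : forall F, N2 (B F) <= K * N2 F.
Hypothesis kernel_trig : forall f, is_trig f -> B (cl f) = 0.

Lemma kernel_ind A : measurable A -> B (cl (ind A)) = 0.
Proof.
move=> mA; apply: (ker_closed K0 BK) => eps eps0.
have [_ h] := measurable_approximable mu_carrier mA.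
have [r [tr r01 Nr]] := h _ eps0.
have br := bmeas_trig tr; have bA := bmeas_ind mA.
exists (cl (fun x => (r x)%:C%C)); first exact: kernel_trig.
rewrite -clB; try exact: bmeas_cLfun2.
apply: le_trans Nr; rewrite -[leRHS]mul1r; apply: N2_le => //.
- exact/bmeas_cLfun2/bmeasB.
- exact/bmeas_cLfun2/bmeasB.
- by move=> x; rewrite mul1r -nsqN opprB.
Qed.

Lemma kernel_nnsfun (s : {nnsfun T >-> R}) : B (cl (fun x => (s x)%:C%C)) = 0.
Proof.
have -> : (fun x => (s x)%:C%C) = (fun x =>
    \sum_(y <- fset_set (range s)) (y%:C)%C * ind (s @^-1` [set y]) x).
  apply/funext => x; rewrite fimfunE fsbig_finite//= rmorph_sum.
  by apply: eq_bigr => y _; rewrite rmorphM.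
have mI y : measurable (s @^-1` [set y]) by exact: measurable_funPTI.
have LI y : ind (s @^-1` [set y]) \in cLfun2 mu by exact/bmeas_cLfun2/bmeas_ind.
have LyI (y : R) : (fun x => (y%:C)%C * ind (s @^-1` [set y]) x) \in cLfun2 mu.
  exact: (rpredZ (y%:C)%C (LI y)).
rewrite cl_sum; last exact: LyI.
by rewrite linear_sum big1// => y _; rewrite clZ// linearZ_LR kernel_ind ?scaler0.
Qed.

(** Increasing simple functions and dominated convergence. *)
Lemma kernel_nonneg (h : T -> R) (M : R) : measurable_fun setT h ->
  (forall x, 0 <= h x <= M) -> B (cl (fun x => (h x)%:C%C)) = 0.
Proof.
move=> mh hM; have mEh : measurable_fun setT (EFin \o h) by exact/measurable_EFinP.
pose s := nnsfun_approx measurableT mEh.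
have h0 x : 0 <= h x by have /andP[] := hM x.
have s_le n x : s n x <= h x.
  rewrite -lee_fin /s nnsfun_approxE; apply: (@le_approx _ _ _ setT (EFin \o h)) => //.
  by move=> y _; rewrite lee_fin.
have s_cvg x : s n x @[n --> \oo] --> h x.
  have : forall x, setT x -> (0 <= (EFin \o h) x)%E by move=> y _; rewrite lee_fin.
  by move/(cvg_nnsfun_approx measurableT mEh) => /(_ x I) /fine_cvgP[].
have bh : bmeas (fun x => (h x)%:C%C).
  split; [exact: mh|exact: measurable_cst|exists (M ^+ 2) => x].
  by rewrite nsq_real lerXn2r ?nnegrE//; have /andP[? ?] := hM x; rewrite ?(le_trans (h0 x)).
have bs n : bmeas (fun x => (s n x)%:C%C).
  split; [exact: measurable_funPT|exact: measurable_cst|exists (M ^+ 2) => x].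
  have /andP[_ hxM] := hM x; have sM := le_trans (s_le n x) hxM.
  by rewrite nsq_real lerXn2r ?nnegrE// (le_trans (h0 x)).
apply: (ker_closed K0 BK) => eps eps0.
pose u n x := (h x)%:C%C - (s n x)%:C%C.
have uE n x : nsq (u n x) = (h x - s n x) ^+ 2 by rewrite -nsq_real rmorphB.
have [||||n hn] := @N2_cvg0 _ mu u (cst (M ^+ 2)) _ _ _ _ eps eps0.
- by move=> n; exact/bmeas_cLfun2/bmeasB.
- exact: finite_measure_integrable_cst.
- move=> n x; rewrite uE /= lerXn2r ?nnegrE ?subr_ge0//.
    by have /andP[? ?] := hM x; exact: le_trans (h0 x) _.
  have /andP[_ hx] := hM x; apply: le_trans hx.
  by rewrite lerBlDr lerDl.
- move=> x; under eq_fun do rewrite uE expr2.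
  have hs : h x - s n x @[n --> \oo] --> h x - h x.
    by apply: cvgB; [exact: cvg_cst|exact: s_cvg].
  have := cvgM hs hs; rewrite subrr mulr0 => hs2; exact: hs2.
exists (cl (fun x => (s n x)%:C%C)); first exact: kernel_nnsfun.
by rewrite -clB; [exact: hn|exact: bmeas_cLfun2..].
Qed.

(** Adding a large constant L to the real and imaginary parts makes them
    nonnegative. *)
Lemma kernel_bmeas f : bmeas f -> B (cl f) = 0.
Proof.
move=> [f1 f2 [M fM]]; pose L := M + 1.
have M0 : 0 <= M by apply: le_trans (fM 0); exact: nsq_ge0.
have bound (t : R) : t ^+ 2 <= M -> 0 <= L + t <= 2 * L.
  move=> tM; have : `|t| <= L.
    rewrite -ler_sqr ?nnegrE// ?real_normK ?num_real//; last by rewrite /L; lra.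
    apply: (le_trans tM); rewrite /L sqrrD1; have := sqr_ge0 M.
    by rewrite mulr2n; lra.
  by rewrite ler_norml => /andP[? ?]; apply/andP; split; lra.
pose a x := L + Re (f x); pose b x := L + Im (f x).
have ma : measurable_fun setT a by apply: measurable_funD => //; exact: measurable_cst.
have mb : measurable_fun setT b by apply: measurable_funD => //; exact: measurable_cst.
have aL x : 0 <= a x <= 2 * L by exact: bound (le_trans (Re_sqr_le_nsq _) (fM x)).
have bL x : 0 <= b x <= 2 * L.
  by apply: bound; apply: le_trans (fM x); rewrite /nsq lerDr sqr_ge0.
have L0 : 0 <= L by rewrite addr_ge0.
have mc : measurable_fun (setT : set T) (cst L : T -> R) by exact: measurable_cst.
have cL (x : T) : 0 <= (cst L x : R) <= L by rewrite /= L0 lexx.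
have bdd (h : T -> R) N : measurable_fun setT h -> (forall x, 0 <= h x <= N) ->
    (fun x => (h x)%:C%C) \in cLfun2 mu.
  move=> mh hN; apply/bmeas_cLfun2; split; [exact: mh|exact: measurable_cst|].
  exists (N ^+ 2) => x; have /andP[h0 h1] := hN x.
  by rewrite nsq_real lerXn2r ?nnegrE// (le_trans h0).
have La := bdd _ _ ma aL; have Lb := bdd _ _ mb bL; have Lc := bdd _ _ mc cL.
have -> : f = (fun x => ((a x)%:C%C + (- 1) * ((cst L x : R)%:C)%C) +
    (Complex 0 1) * ((b x)%:C%C + (- 1) * ((cst L x : R)%:C)%C)).
  apply/funext => x; rewrite /a /b /=; case: (f x) => u v /=.
  by apply/eqP; rewrite eq_complex /=; apply/andP; split; apply/eqP; ring.
have LcN : (fun x : T => (- 1) * ((cst L x : R)%:C)%C) \in cLfun2 mu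
  := rpredZ (-1) Lc.
have Lac : (fun x : T => (a x)%:C%C + (- 1) * ((cst L x : R)%:C)%C) \in cLfun2 mu
  := rpredD La LcN.
have Lbc : (fun x : T => (b x)%:C%C + (- 1) * ((cst L x : R)%:C)%C) \in cLfun2 mu
  := rpredD Lb LcN.
have Libc : (fun x : T => Complex 0 1 *
    ((b x)%:C%C + (- 1) * ((cst L x : R)%:C)%C)) \in cLfun2 mu
  := rpredZ (Complex 0 1) Lbc.
have Bc : B (cl (fun x : T => (- 1) * ((cst L x : R)%:C)%C)) = 0.
  by rewrite clZ// linearZ_LR (kernel_nonneg mc cL) scaler0.
rewrite (clD Lac Libc) (clZ _ Lbc) (clD La LcN) (clD Lb LcN) linearD linearZ_LR !linearD Bc.
by rewrite (kernel_nonneg ma aL) (kernel_nonneg mb bL) !(addr0, linear0).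
Qed.

(** The density of trigonometric polynomials in L^2(mu), read on the kernel of a
    bounded operator.  Truncating f to the set where |f|^2 <= n reduces to
    bounded functions. *)
Lemma vanishing_on_trig_eq0 F : B F = 0.
Proof.
have [f Lf ->] := cl_repr F; apply: (ker_closed K0 BK) => eps eps0.
have mq := cLfun2_measurable_nsq Lf.
pose A (n : nat) : set T := [set x | nsq (f x) <= n%:R].
have mA n : measurable (A n).
  rewrite (_ : A n = setT `&` (fun x => nsq (f x)) @^-1` [set` `]-oo, n%:R]]).
    by move/measurable_EFinP: mq; apply => //; exact: measurable_itv.
  by apply/seteqP; split => x /=; rewrite in_itv//= => -[].
have bfA n : bmeas (fun x => f x * ind (A n) x).
  have mI := measurable_indic (mA n).
  move: (Lf) => /andP[/andP[+ _] /andP[+ _]]; rewrite !inE /= => mR mI'.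
  split.
  - rewrite (_ : (fun _ => _) = (fun x => Re (f x) * \1_(A n) x)).
      exact: measurable_funM.
    by apply/funext => x; case: (f x) => ? ? /=; rewrite mulr0 subr0.
  - rewrite (_ : (fun _ => _) = (fun x => Im (f x) * \1_(A n) x)).
      exact: measurable_funM.
    by apply/funext => x; case: (f x) => ? ? /=; rewrite mulr0 add0r.
  - exists n%:R => x; rewrite nsqM nsq_real indicE.
    have [Ax|Ax] := boolP (x \in A n); last by rewrite expr0n mulr0.
    by rewrite expr1n mulr1; move: Ax; rewrite inE.
pose u n x := f x - f x * ind (A n) x.
have uE n x : nsq (u n x) = if x \in A n then 0 else nsq (f x).
  rewrite /u /ind indicE; case: (x \in A n); rewrite /= ?mulr1 ?mulr0 ?subr0//.
  by rewrite subrr /nsq /= expr0n addr0.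
have [||||n hn] := @N2_cvg0 _ mu u (fun x => nsq (f x)) _ _ _ _ eps eps0.
- by move=> n; apply: rpredB => //; exact: bmeas_cLfun2.
- apply/integrableP; split=> //; under eq_integral do rewrite /= ger0_norm ?nsq_ge0//.
  by rewrite -N2_cl// ltry.
- by move=> n x; rewrite uE; case: ifP => // _; exact: nsq_ge0.
- move=> x; apply: cvg_near_cst; exists (Num.truncn (nsq (f x))).+1 => // n /= hn.
  rewrite uE mem_set//; rewrite /A /=; apply: le_trans (ltW (truncnS_gt _)) _.
  by rewrite ler_nat.
exists (cl (fun x => f x * ind (A n) x)); first exact: kernel_bmeas.
by rewrite -clB//; exact: bmeas_cLfun2.
Qed.

End KernelDense.

Theorem theorem7p2 (R : realType) (mu : probability (measurableTypeR R) R)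
  (mu_carrier : mu [set` `[0%R, 1%R[] = 1%E)
  (mu_singular : mutually_singular mu
     (mrestr (@lebesgue_measure R) (@measurable_itv R `[0%R, 1%R[))) :
  ~ extends_to_CFC (L2dot (mu := mu)) (expL2 mu).
Proof.
move=> [J [h [B [M BM] pars]]].
have N2E F : N2 F = hnorm (L2dot (mu := mu)) F ^+ 2 by rewrite hnorm_sqr.
have BK F : N2 (B F) <= M ^+ 2 * N2 F.
  rewrite !N2E -exprMn lerXn2r ?nnegrE ?sqrtr_ge0//.
  by apply: le_trans (BM F); exact: sqrtr_ge0.
have Bsynth n m (a : nat -> R[i]) :
    N2 (B (\sum_(i < n) a i *: expL2 mu (m + i))) <= \sum_(i < n) nsq (a i).
  rewrite N2E linear_sum.
  have := @Parseval_synthesis_le _ _ (L2dot (mu := mu)) _ _ n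
    (fun i => inl (m + i)%N) (fun i => a i) pars.
  under eq_bigr do rewrite -linearZ_LR.
  by apply=> i j [] /addnI /val_inj.
have B0 := vanishing_on_trig_eq0 mu_carrier (sqr_ge0 M) BK
  (kernel_trig mu_carrier mu_singular (sqr_ge0 M) BK Bsynth).
have L1 : (fun=> 1 : R[i]) \in cLfun2 mu by exact/bmeas_cLfun2/bmeas_cst.
have := pars (cl mu (fun=> 1)); rewrite -N2E N2_cl//.
under eq_integral do rewrite nsq1.
rewrite integral_cst// [X in (_ * X)%E](@probability_setT _ _ _ mu) mule1.
rewrite esum1 => [/eqP|k _]; first by rewrite eqe eq_sym oner_eq0.
by rewrite nsq_normc /= B0 linear0r /nsq /= expr0n addr0.
Qed.
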